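(* Let $H\in(0,1)$, let $(B^H_t)_{t\ge0}$ be a fractional Brownian motion with Hurst parameter $H$, and let $X_0$ be a real random variable independent of $(B^H_t)_{t\ge0}$ with finite second moment. Let $X_t=X_0+B^H_t$ for $t\ge0$, and for $t>0$ set $$g(t,H,X_t):=2H^2t^{4H-2}J_1(X_t)^2+H(2H-1)t^{2H-2}J_1(X_t)+Ht^{2H-1}\frac{d}{dt}J_1(X_t).$$ Then for every $t>0$, $$\frac{d^2}{dt^2}N(X_t)=2N(X_t)\,g(t,H,X_t),$$ where $N$ is the entropy power. Consequently, $t\mapsto N(X_t)$ is convex on any open interval of $t>0$ on which $g(t,H,X_t)>0$, and concave on any open interval of $t>0$ on which $g(t,H,X_t)\le0$. In particular, if $X_0$ is Gaussian with mean $0$ and variance $\sigma_0^2$, then $g(t,H,X_t)=H(2H-1)t^{2H-2}J_1(X_t)$ for all $t>0$, and $t\mapsto N(X_t)$ is convex in $t$ if $H\in(1/2,1)$ and concave in $t$ if $H\in(0,1/2]$.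
   Context: A fractional Brownian motion $(B^H_t)_{t\ge0}$ with Hurst parameter $H\in(0,1)$ is a centered Gaussian process with stationary increments and covariance $\mathbb{E}[B^H_sB^H_t]=\tfrac12(t^{2H}+s^{2H}-|t-s|^{2H})$. For a random variable $X$ with probability density $f_X$, the Shannon entropy is $h(X):=-\mathbb{E}[\ln f_X(X)]=-\int_{\mathbb{R}}f_X(x)\ln f_X(x)\,dx$, the Fisher information is $J_1(X):=\mathbb{E}\big[\big(\tfrac{\partial}{\partial x}\ln f_X(X)\big)^2\big]$ (the derivative of $\ln f_X$ being evaluated at $X$), and the entropy power is $N(X):=\frac{1}{2\pi e}e^{2h(X)}$. Convexity and concavity in $t$ are for $t>0$. *)

(* Defs.v *)
From HB Require Import structures.
From mathcomp Require Import all_boot all_order all_algebra.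
From mathcomp Require Import all_classical all_reals all_analysis.

Set Implicit Arguments.
Unset Strict Implicit.
Unset Printing Implicit Defensive.

Import Order.TTheory GRing.Theory Num.Theory.
Import numFieldNormedType.Exports.

Local Open Scope classical_set_scope.
Local Open Scope ring_scope.

Section defs.
Context {d : measure_display} {T : measurableType d} {R : realType}.
Variable P : probability T R.

(* The variance [v] may be [0], in which case the law is the point mass at [m];
   [normal_prob m 0] is not that law. *)
Definition gaussian_law (m v : R) (X : T -> R) : Prop :=
  forall A : set R, measurable A ->
    P (X @^-1` A) =
    if v == 0 then \d_m A else normal_prob m (Num.sqrt v) A.

(* Processes are indexed by [R]; only the times [t >= 0] are constrained. *)

Definition gaussian_process (B : R -> {RV P >-> R}) : Prop :=
  forall (n : nat) (t c : 'I_n -> R), (forall i, 0 <= t i) ->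
    exists m v : R, 0 <= v /\
      gaussian_law m v (fun w => \sum_(i < n) c i * B (t i) w).

Definition centered_process (B : R -> {RV P >-> R}) : Prop :=
  forall t, 0 <= t -> 'E_P[B t]%E = 0%E.

(* Equality of the finite-dimensional laws of [B_(h + t) - B_h] and
   [B_t - B_0], tested on measurable rectangles. *)
Definition stationary_increments (B : R -> {RV P >-> R}) : Prop :=
  forall (h : R) (n : nat) (t : 'I_n -> R) (A : 'I_n -> set R),
    0 <= h -> (forall i, 0 <= t i) -> (forall i, measurable (A i)) ->
    P [set w | forall i, A i (B (h + t i) w - B h w)] =
    P [set w | forall i, A i (B (t i) w - B 0 w)].

Definition fractional_brownian_motion (H : R) (B : R -> {RV P >-> R}) : Prop :=
  [/\ gaussian_process B,
      centered_process B,
      stationary_increments B &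
      forall s t, 0 <= s -> 0 <= t ->
        'E_P[(fun w => B s w * B t w)%R]%E =
        (2^-1 * (t `^ (2 * H) + s `^ (2 * H) - `|t - s| `^ (2 * H)))%:E].

Definition sigma_rv (X : {RV P >-> R}) : set (set T) :=
  preimage_set_system setT X measurable.

Definition sigma_process (B : R -> {RV P >-> R}) : set (set T) :=
  <<s \bigcup_(t in [set t | 0 <= t]) sigma_rv (B t) >>.

Definition independent_rv_process (X : {RV P >-> R})
    (B : R -> {RV P >-> R}) : Prop :=
  forall E F : set T, sigma_rv X E -> sigma_process B F ->
    P (E `&` F) = (P E * P F)%E.

Definition is_density (X : {RV P >-> R}) (f : R -> R) : Prop :=
  [/\ measurable_fun setT f, (forall x, 0 <= f x) &
      forall A, measurable A ->
        distribution P X A = (\int[lebesgue_measure]_(x in A) (f x)%:E)%E].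

(* A density is determined only almost everywhere; the derivative in the Fisher
   information is meaningful because the continuous version, which is unique,
   is selected whenever there is one. *)
Definition density (X : {RV P >-> R}) : R -> R :=
  get [set f : R -> R | is_density X f /\
    ((exists2 g : R -> R, is_density X g & continuous g) -> continuous f)].

Definition entropy (X : {RV P >-> R}) : \bar R :=
  (- 'E_P[(fun w => ln (density X (X w)))%R])%E.

Definition fisher_information (X : {RV P >-> R}) : \bar R :=
  'E_P[(fun w => ((fun x => ln (density X x))^`()%classic (X w)) ^+ 2)%R]%E.

Definition entropy_power (X : {RV P >-> R}) : \bar R :=
  (((2 * pi * expR 1)^-1)%:E * expeR (2%:E * entropy X))%E.

Definition J1 (X : R -> {RV P >-> R}) (t : R) : R :=
  fine (fisher_information (X t)).

Definition N (X : R -> {RV P >-> R}) (t : R) : R :=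
  fine (entropy_power (X t)).

Definition g (H : R) (X : R -> {RV P >-> R}) (t : R) : R :=
  2 * H ^+ 2 * t `^ (4 * H - 2) * J1 X t ^+ 2
  + H * (2 * H - 1) * t `^ (2 * H - 2) * J1 X t
  + H * t `^ (2 * H - 1) * (J1 X)^`()%classic t.

End defs.

Definition convex_on (R : realType) (I : set R) (f : R -> R) : Prop :=
  @convex_function R R^o I f.

Definition concave_on (R : realType) (I : set R) (f : R -> R) : Prop :=
  @convex_function R R^o I (fun t => - f t).

(* Main.v *)
Require Import Defs.
From HB Require Import structures.
From mathcomp Require Import all_boot all_order all_algebra.
From mathcomp Require Import all_classical all_reals all_analysis.
From mathcomp Require Import measurable_realfun ring lra.

Set Implicit Arguments.
Unset Strict Implicit.
Unset Printing Implicit Defensive.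

Import Order.TTheory GRing.Theory Num.Theory.
Import numFieldNormedType.Exports.

Local Open Scope classical_set_scope.
Local Open Scope ring_scope.

(** The law of [X0 + B_t] is the law [mu] of [X0] convolved with a centered
Gaussian of variance [s = t `^ (2 * H)], so the fractional Brownian flow is the
heat flow run with the clock [t |-> t `^ (2 * H)].  Once the entropy [h(s)] and
the Fisher information [J(s)] along the heat flow are known to satisfy de
Bruijn's identity [h' = J / 2] with [J] differentiable, the theorem is the chain
rule applied to a multiple of [exp (2 h)]: the entropy power [N] satisfies
[N' = 2 H t^(2H-1) J N], and differentiating once more gives [N'' = 2 N g].
Convexity and concavity follow because [N] is positive, and for a Gaussian [X0]
of variance [v] one has [J = 1 / (s + v)], which cancels the first and the last
term of [g].

The analytic work is to differentiate under the integral sign when [X0] has only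
two moments.  Every derivative of the density [f(s, x)] of the flow is a
combination of the integrals
  [M_k(s, x) = int (x - y)^k K_s(x - y) mu(dy)],   [f = M_0],
where [K_s] is the Gaussian density of variance [s]; they obey
  [d_x M_k = k M_(k-1) - M_(k+1) / s],
  [d_s M_k = M_(k+2) / (2 s^2) - M_k / (2 s)].
For [s] in a compact interval [[a, b]] of positive numbers, three bounds suffice:
- [|M_k(s, x)| <= C f(2b, x)], a polynomial times a Gaussian being dominated by
  a wider Gaussian ([flow_moment_dom]);
- [|ln f(s, x)| <= C (1 + x^2)], from a Gaussian lower bound on [f] given by
  Jensen's inequality ([ln_flow_density_bound]);
- [|M_1(s, x)| <= C (1 + |x|) f(s, x)], that is, a score of at most linear growth
  ([flow_moment1_ratio]).
They dominate the integrands of [h], of [J] and of their [s]-derivatives by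
multiples of [(1 + x^2) f(2b, x)], which is integrable because [mu] and the
Gaussian have second moments.  Integrating the derivative of
[d_x f * (1 + ln f)] over the line, with boundary terms controlled by
[(1 + x^2) f -> 0], turns the resulting formula for [h'] into [J / 2].

On the probabilistic side, the marginals of the fractional Brownian motion are
identified from their first two moments, independence turns the joint law of
[(X0, B_t)] into a product measure, and Tonelli's theorem produces the density
[f].  As [f] is continuous it is the version of the density selected in the
definitions of the entropy and of the Fisher information. *)

(** * Integrals of real functions under domination *)

Section under_integral.
Context {R : realType} {d : measure_display} {Y : measurableType d}.
Variable mu : {measure set Y -> \bar R}.

(** Differentiation under the integral sign packaged as an [is_derive] statement, so
that it composes with the chain and product rules. *)
Lemma is_derive_under_integral (f df : R -> Y -> R) (G : Y -> R) (a u v : R) :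
  u < a -> a < v ->
  (forall x, u < x -> x < v -> mu.-integrable setT (EFin \o f x)) ->
  (forall x y, u < x -> x < v -> is_derive x 1 (f ^~ y) (df x y)) ->
  mu.-integrable setT (EFin \o G) ->
  (forall x y, u < x -> x < v -> `|df x y| <= G y) ->
  is_derive a 1 (fun x => \int[mu]_y f x y) (\int[mu]_y df a y).
Proof.
move=> ua av intf derf intG dfG.
have Ia : `]u, v[%classic a by rewrite /= in_itv/= ua av.
have d1E x y : u < x -> x < v -> partial1of2 f x y = df x y.
  by move=> ux xv; rewrite /partial1of2 derive1E; have [_ ->] := derf x y ux xv.
have intf' x : `]u, v[%classic x -> mu.-integrable setT (EFin \o f x).
  by rewrite /= in_itv/= => /andP[ux xv]; exact: intf.
have derf' x y : `]u, v[%classic x -> setT y -> derivable (f ^~ y) x 1.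
  by rewrite /= in_itv/= => /andP[ux xv] _; have [] := derf x y ux xv.
have G0 y : 0 <= G y by rewrite (le_trans _ (dfG a y ua av)).
have Gub x y : `]u, v[%classic x -> setT y -> `|partial1of2 f x y| <= G y.
  by rewrite /= in_itv/= => /andP[ux xv] _; rewrite d1E// dfG.
split; first exact: (derivable_under_integral measurableT Ia intf' derf' G0 intG
  Gub).
rewrite -derive1E (differentiation_under_integral measurableT Ia intf' derf' G0
  intG Gub).
by apply: eq_Rintegral => y _; rewrite d1E.
Qed.

Lemma integrable_dominated (f G : Y -> R) :
  measurable_fun setT f -> mu.-integrable setT (EFin \o G) ->
  (forall y, `|f y| <= G y) -> mu.-integrable setT (EFin \o f).
Proof.
move=> mf iG fG; apply: (le_integrable measurableT _ _ iG).
  exact/measurable_EFinP.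
by move=> y _ /=; rewrite lee_fin (le_trans (fG y))// ler_norm.
Qed.

Lemma cvg_Rintegral_dominated (f_ : nat -> Y -> R) (f G : Y -> R) :
  (forall n, measurable_fun setT (f_ n)) ->
  (forall y, f_ n y @[n --> \oo] --> f y) ->
  mu.-integrable setT (EFin \o f) ->
  mu.-integrable setT (EFin \o G) ->
  (forall n y, `|f_ n y| <= G y) ->
  \int[mu]_y f_ n y @[n --> \oo] --> \int[mu]_y f y.
Proof.
move=> mf ff iF iG fG; apply: fine_cvg.
rewrite fineK; last exact: integrable_fin_num iF.
apply: (@dominated_cvg _ _ _ mu setT measurableT
  (fun n y => (f_ n y)%:E) _ (EFin \o G)) => //.
- by move=> n; exact/measurable_EFinP.
- by move=> y _; apply: cvg_EFin; [exact: nearW|exact: ff].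
- by move=> n y _ /=; rewrite lee_fin.
Qed.

Lemma integrable_cstZ c (f : Y -> R) : mu.-integrable setT (EFin \o f) ->
  mu.-integrable setT (EFin \o (fun y => c * f y)).
Proof. by move=> /(integrableZl measurableT c). Qed.

Lemma integrable_add (f g : Y -> R) : mu.-integrable setT (EFin \o f) ->
  mu.-integrable setT (EFin \o g) ->
    mu.-integrable setT (EFin \o (fun y => f y + g y)).
Proof. by move=> hf hg; have := integrableD measurableT hf hg. Qed.

Lemma integrable_sub (f g : Y -> R) : mu.-integrable setT (EFin \o f) ->
  mu.-integrable setT (EFin \o g) ->
    mu.-integrable setT (EFin \o (fun y => f y - g y)).
Proof. by move=> hf hg; have := integrableB measurableT hf hg. Qed.

End under_integral.

(** * Differentiation rules *)

Section derivatives.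
Context {R : realType}.
Implicit Types (f g : R -> R) (x df dg c : R).

(** The rules below are stated for functions written with a binder, so that
[apply] finds the shape of a concrete formula by unification; the pointwise
operations on function spaces do not unify with such formulas. *)
Lemma is_derive_cst_fun c x : is_derive x 1 (fun=> c) (0 : R).
Proof. exact: is_derive_cst. Qed.

Lemma is_derive_id_fun x : is_derive x 1 (fun y => y) (1 : R).
Proof. exact: is_derive_id. Qed.

Lemma is_deriveD_fun {f g x df dg} : is_derive x 1 f df -> is_derive x 1 g dg ->
  is_derive x 1 (fun y => f y + g y) (df + dg).
Proof. exact: is_deriveD. Qed.

Lemma is_deriveB_fun {f g x df dg} : is_derive x 1 f df -> is_derive x 1 g dg ->
  is_derive x 1 (fun y => f y - g y) (df - dg).
Proof. exact: is_deriveB. Qed.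

Lemma is_deriveN_fun {f x df} : is_derive x 1 f df ->
  is_derive x 1 (fun y => - f y) (- df).
Proof. exact: is_deriveN. Qed.

Lemma is_deriveM_fun {f g x df dg} : is_derive x 1 f df -> is_derive x 1 g dg ->
  is_derive x 1 (fun y => f y * g y) (df * g x + f x * dg).
Proof.
move=> hf hg; apply: (is_derive_eq (is_deriveM hf hg)).
by rewrite /GRing.scale/= addrC mulrC.
Qed.

Lemma is_deriveZ_fun c {f x df} : is_derive x 1 f df ->
  is_derive x 1 (fun y => c * f y) (c * df).
Proof.
by move=> hf; apply: (is_derive_eq (is_deriveM_fun (is_derive_cst_fun c x) hf));
  rewrite mul0r add0r.
Qed.

Lemma is_deriveX_fun n {f x df} : is_derive x 1 f df ->
  is_derive x 1 (fun y => f y ^+ n) (n%:R * f x ^+ n.-1 * df).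
Proof.
move=> hf; have := is_deriveX n hf; rewrite /GRing.scale/=.
by have -> : f ^+ n = (fun y => f y ^+ n) by apply/funext => y; rewrite fctE.
Qed.

Lemma is_deriveV_fun {f x df} : f x != 0 -> is_derive x 1 f df ->
  is_derive x 1 (fun y => (f y)^-1) (- df / f x ^+ 2).
Proof.
move=> fx hf; apply: (is_derive_eq (is_deriveV fx hf)).
by rewrite /GRing.scale/= !mulNr mulrC.
Qed.

Lemma is_derive_comp_fun {f g x df dg} : is_derive (g x) 1 f df ->
  is_derive x 1 g dg ->
  is_derive x 1 (fun y => f (g y)) (df * dg).
Proof. exact: is_derive1_comp. Qed.

Lemma is_derive_continuous f x df : is_derive x 1 f df -> {for x, continuous f}.
Proof.
by move=> [? _]; apply: differentiable_continuous; exact/derivable1_diffP.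
Qed.

End derivatives.

(** * The Gaussian kernel *)

Section kernel.
Context {R : realType}.
Implicit Types (s z x y : R) (k : nat).

(** The centered Gaussian density, parametrised by its variance [s], which is the
time of the heat flow. *)
Definition heat_kernel s z : R := (Num.sqrt (s * (2 * pi)))^-1 * expR
  (- (z ^+ 2 / (2 * s))).

Definition kernel_moment k s z : R := z ^+ k * heat_kernel s z.

Let pi2 : 0 < 2 * pi :> R. Proof. by rewrite mulr_gt0// pi_gt0. Qed.

Lemma normal_pdf_heat_kernel s m x : 0 < s ->
  normal_pdf m (Num.sqrt s) x = heat_kernel s (x - m).
Proof.
move=> s0; rewrite normal_pdfE ?gt_eqF ?sqrtr_gt0// /heat_kernel /normal_peak
  /normal_fun.
rewrite sqr_sqrtr ?ltW//; congr (_^-1 * expR _).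
  by rewrite -mulr_natl; congr Num.sqrt; ring.
by rewrite -[s *+ 2]mulr_natl mulNr.
Qed.

Lemma heat_kernel_gt0 s z : 0 < s -> 0 < heat_kernel s z.
Proof.
by move=> s0; rewrite mulr_gt0 ?expR_gt0// invr_gt0 sqrtr_gt0 mulr_gt0.
Qed.

Lemma heat_kernel_le s z : 0 < s ->
  heat_kernel s z <= (Num.sqrt (s * (2 * pi)))^-1.
Proof.
move=> s0; rewrite /heat_kernel ler_piMr ?invr_ge0 ?sqrtr_ge0// expR_le1
  oppr_le0.
by rewrite divr_ge0 ?sqr_ge0// mulr_ge0// ltW.
Qed.

Lemma is_derive_heat_kernel_z s z : 0 < s ->
  is_derive z 1 (heat_kernel s) (- (z / s) * heat_kernel s z).
Proof.
move=> s0.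
have h1 : is_derive z 1 (fun z => - (z ^+ 2 / (2 * s))) (- (z / s)).
  apply: (is_derive_eq (is_deriveN_fun
    (is_deriveM_fun (is_deriveX_fun 2 (is_derive_id_fun z))
    (is_derive_cst_fun (2 * s)^-1 z)))).
  by field; rewrite gt_eqF.
apply: (is_derive_eq (is_deriveZ_fun _
  (is_derive_comp_fun (is_derive_expR _) h1))).
by rewrite /heat_kernel; ring.
Qed.

(** Together with [is_derive_heat_kernel_z] this is the heat equation
[d_s K = (1/2) d_zz K]. *)
Lemma is_derive_heat_kernel_s s z : 0 < s ->
  is_derive s 1 (heat_kernel ^~ z)
    ((z ^+ 2 / (2 * s ^+ 2) - (2 * s)^-1) * heat_kernel s z).
Proof.
move=> s0; have sn0 : s != 0 by rewrite gt_eqF.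
have p0 : 0 < s * (2 * pi) by rewrite mulr_gt0.
have q0 : Num.sqrt (s * (2 * pi)) != 0 by rewrite gt_eqF// sqrtr_gt0.
have h2 : is_derive s 1 (fun s => (Num.sqrt (s * (2 * pi)))^-1)
    (- (2 * s)^-1 * (Num.sqrt (s * (2 * pi)))^-1).
  have hg : is_derive s 1 (fun s => s * (2 * pi)) (2 * pi).
    by apply: (is_derive_eq (is_deriveM_fun (is_derive_id_fun s)
      (is_derive_cst_fun (2 * pi) s))); ring.
  have hs := is_derive_comp_fun (g := fun s => s * (2 * pi))
    (is_derive1_sqrt p0) hg.
  have hv := is_deriveV_fun (f := fun s => Num.sqrt (s * (2 * pi))) q0 hs.
  apply: (is_derive_eq hv).
  set q := Num.sqrt _ in q0 *;
    have qE : q ^+ 2 = s * (2 * pi) by rewrite sqr_sqrtr// ltW.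
  have -> : 2 * pi = q ^+ 2 / s by rewrite qE; field.
  by field; rewrite q0.
have h1 : is_derive s 1 (fun s => - (z ^+ 2 / (2 * s))) (z ^+ 2 / (2 * s ^+ 2)).
  have s20 : 2 * s != 0 by rewrite mulf_neq0.
  apply: (is_derive_eq (is_deriveN_fun
    (is_deriveZ_fun (z ^+ 2) (is_deriveV_fun s20
    (is_deriveZ_fun 2 (is_derive_id_fun s)))))).
  by field.
apply: (is_derive_eq (is_deriveM_fun h2
  (is_derive_comp_fun (is_derive_expR _) h1))).
by rewrite /heat_kernel; ring.
Qed.

Lemma is_derive_kernel_moment_z k s z : 0 < s ->
  is_derive z 1 (kernel_moment k s)
    (k%:R * kernel_moment k.-1 s z - kernel_moment k.+1 s z / s).
Proof.
move=> s0; apply: (is_derive_eq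
  (is_deriveM_fun (is_deriveX_fun k (is_derive_id_fun z))
  (is_derive_heat_kernel_z z s0))).
by rewrite /kernel_moment exprS; ring.
Qed.

Lemma is_derive_kernel_moment_s k s z : 0 < s ->
  is_derive s 1 (kernel_moment k ^~ z)
    (kernel_moment k.+2 s z / (2 * s ^+ 2) - kernel_moment k s z / (2 * s)).
Proof.
move=> s0; apply: (is_derive_eq
  (is_deriveZ_fun (z ^+ k) (is_derive_heat_kernel_s z s0))).
by rewrite /kernel_moment !exprS; ring.
Qed.

Lemma continuous_kernel_moment k s : 0 < s -> continuous (kernel_moment k s).
Proof.
by move=> s0 z; exact: (is_derive_continuous
  (is_derive_kernel_moment_z k z s0)).
Qed.

Lemma measurable_kernel_moment k s : 0 < s ->
  measurable_fun setT (kernel_moment k s).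
Proof.
move=> s0; apply: continuous_measurable_fun; exact: continuous_kernel_moment.
Qed.

Lemma integral_heat_kernel_shift s y : 0 < s ->
  (\int[lebesgue_measure]_x (heat_kernel s (x - y))%:E = 1)%E.
Proof.
move=> s0; rewrite -(integral_normal_pdf y (Num.sqrt s)).
by apply: eq_integral => x _; rewrite normal_pdf_heat_kernel.
Qed.

(** A polynomial is absorbed by an arbitrarily small part of a Gaussian exponent. *)
Lemma expr_le_expR_sqr k (c : R) : 0 < c ->
  exists2 C : R, 0 < C & forall z, `|z| ^+ k <= C * expR (c * z ^+ 2).
Proof.
(* [k.+1] rather than [k], to cover [k = 0]. *)
move=> c0; pose e := c / k.+1%:R.
have e0 : 0 < e by rewrite divr_gt0.
exists ((1 + e^-1) ^+ k) => [|z];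
  first by rewrite exprn_gt0// addr_gt0// invr_gt0.
have h : `|z| <= (1 + e^-1) * expR (e * z ^+ 2).
  apply: (@le_trans _ _ ((1 + e^-1) * (1 + e * z ^+ 2))); last first.
    by rewrite ler_wpM2l ?expR_ge1Dx// addr_ge0// invr_ge0 ltW.
  have -> : (1 + e^-1) * (1 + e * z ^+ 2) = 1 + e^-1 + e * z ^+ 2 + z ^+ 2.
    by field; rewrite gt_eqF.
  have ei : 0 <= e^-1 by rewrite invr_ge0 ltW.
  have ez : 0 <= e * z ^+ 2 by rewrite mulr_ge0 ?sqr_ge0 ?ltW.
  rewrite -[z ^+ 2]real_normK ?num_real// in ez *; nra.
apply: (@le_trans _ _ (((1 + e^-1) * expR (e * z ^+ 2)) ^+ k)).
  by rewrite lerXn2r ?nnegrE// mulr_ge0 ?expR_ge0// addr_ge0// invr_ge0 ltW.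
rewrite exprMn ler_wpM2l ?exprn_ge0 ?addr_ge0 ?invr_ge0 ?(ltW e0)//.
rewrite -expRM_natl ler_expR mulrA ler_wpM2r ?sqr_ge0//.
rewrite /e mulrCA ler_piMr ?(ltW c0)// ler_pdivrMr// mul1r ler_nat.
exact: leqnSn.
Qed.

(** Half of the exponent [z^2 / (2 s)] absorbs the power of [z], the other half is
the exponent of the kernel of variance [2 b]; this makes the bound uniform in [s]. *)
Lemma kernel_moment_dom k (a b : R) : 0 < a -> a <= b ->
  exists2 C : R, 0 < C & forall s z, a <= s -> s <= b ->
    `|kernel_moment k s z| <= C * heat_kernel (2 * b) z.
Proof.
move=> a0 ab; have b0 : 0 < b by apply: lt_le_trans ab.
have b4 : 0 < (4 * b)^-1 by rewrite invr_gt0 mulr_gt0.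
have [C C0 hC] := expr_le_expR_sqr k b4.
exists ((Num.sqrt (a * (2 * pi)))^-1 * C * Num.sqrt (2 * b * (2 * pi))).
  by rewrite !mulr_gt0// ?invr_gt0 sqrtr_gt0 mulr_gt0// mulr_gt0.
move=> s z as_ sb; have s0 : 0 < s by apply: lt_le_trans as_.
rewrite /kernel_moment /heat_kernel normrM normrX.
set q := Num.sqrt (2 * b * (2 * pi)).
have q0 : q != 0 by rewrite gt_eqF// sqrtr_gt0 mulr_gt0// mulr_gt0.
rewrite -[X in _ <= X]mulrA mulVKf// -[X in _ <= X]mulrA.
rewrite [X in _ * X]ger0_norm; last first.
  by rewrite mulr_ge0 ?expR_ge0// invr_ge0 sqrtr_ge0.
have hE : expR (- (z ^+ 2 / (2 * s))) <= expR (- (z ^+ 2 / (4 * b))) * expR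
  (- (z ^+ 2 / (2 * (2 * b)))).
  rewrite -expRD ler_expR -opprD lerN2.
  have -> : z ^+ 2 / (4 * b) + z ^+ 2 / (2 * (2 * b)) = z ^+ 2 / (2 * b)
    by field; rewrite gt_eqF.
  by rewrite ler_wpM2l ?sqr_ge0// lef_pV2 ?posrE ?mulr_gt0// ler_pM2l.
have hz : `|z| ^+ k * expR (- (z ^+ 2 / (4 * b))) <= C.
  rewrite expRN ler_pdivrMr ?expR_gt0// (le_trans (hC z))//.
  by rewrite [_ / (4 * b)]mulrC.
rewrite mulrCA; apply: ler_pM.
- by rewrite invr_ge0 sqrtr_ge0.
- by rewrite mulr_ge0 ?expR_ge0// exprn_ge0.
- have pa : 0 < Num.sqrt (a * (2 * pi)) by rewrite sqrtr_gt0 mulr_gt0.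
  have ps : 0 < Num.sqrt (s * (2 * pi)) by rewrite sqrtr_gt0 mulr_gt0.
  by rewrite lef_pV2// ler_wsqrtr// ler_pM2r.
rewrite (le_trans (ler_wpM2l _ hE)) ?exprn_ge0// [X in X <= _]mulrA.
by apply: ler_wpM2r => //; exact: expR_ge0.
Qed.

Lemma kernel_moment_bounded k (a b : R) : 0 < a -> a <= b ->
  exists2 C : R, 0 < C & forall s z, a <= s -> s <= b ->
    `|kernel_moment k s z| <= C.
Proof.
move=> a0 ab; have b0 : 0 < b by apply: lt_le_trans ab.
have [C C0 hC] := kernel_moment_dom k a0 ab.
exists (C * (Num.sqrt (2 * b * (2 * pi)))^-1).
  by rewrite mulr_gt0// invr_gt0 sqrtr_gt0 mulr_gt0// mulr_gt0.
move=> s z h1 h2; rewrite (le_trans (hC s z h1 h2))// ler_wpM2l ?(ltW C0)//.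
by rewrite heat_kernel_le// mulr_gt0.
Qed.

End kernel.

(** * Moments of the heat flow of a probability measure *)

Section heat_flow.
Context {R : realType}.
Variable mu : probability R R.
Implicit Types (s x y z : R) (k : nat).

Lemma Rintegral_prob_cst (c : R) : \int[mu]_y c = c.
Proof.
have h : fine (mu setT) = 1 by rewrite (probability_setT mu).
exact: etrans (Rintegral_cst _ measurableT c)
  (etrans (congr1 (fun t => c * t) h) (mulr1 c)).
Qed.

Definition flow_moment k s x : R := \int[mu]_y kernel_moment k s (x - y).

Lemma measurable_kernel_moment_shift k s x : 0 < s ->
  measurable_fun setT (fun y => kernel_moment k s (x - y)).
Proof.
move=> s0; apply: (measurableT_comp (measurable_kernel_moment k s0)).
exact: measurable_funB.
Qed.

Lemma integrable_kernel_moment_shift k s x : 0 < s ->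
  mu.-integrable setT (EFin \o (fun y => kernel_moment k s (x - y))).
Proof.
move=> s0; have [C C0 hC] := kernel_moment_bounded k s0 (lexx s).
apply: (@integrable_dominated _ _ _ mu _ (cst C)).
- exact: measurable_kernel_moment_shift.
- exact: finite_measure_integrable_cst.
- by move=> y; exact: hC.
Qed.

Lemma is_derive_flow_moment_x k s x : 0 < s ->
  is_derive x 1 (flow_moment k s)
    (k%:R * flow_moment k.-1 s x - flow_moment k.+1 s x / s).
Proof.
move=> s0.
have [C C0 hC] := kernel_moment_bounded k.-1 s0 (lexx s).
have [C' C'0 hC'] := kernel_moment_bounded k.+1 s0 (lexx s).
pose df x y := k%:R * kernel_moment k.-1 s (x - y) - kernel_moment k.+1 s
  (x - y) / s.
have hd : is_derive x 1 (flow_moment k s) (\int[mu]_y df x y).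
  apply: (@is_derive_under_integral _ _ _ mu
    (fun x y => kernel_moment k s (x - y)) df
    (cst (k%:R * C + C' / s)) x (x - 1) (x + 1)).
  - by rewrite ltrBlDr ltrDl.
  - by rewrite ltrDl.
  - by move=> z _ _; exact: integrable_kernel_moment_shift.
  - move=> z y _ _; have hs : is_derive z 1 (fun z => z - y) 1.
      by apply: (is_derive_eq (is_deriveB_fun (is_derive_id_fun z)
        (is_derive_cst_fun y z))); rewrite subr0.
    apply: (is_derive_eq (is_derive_comp_fun (g := fun z => z - y)
      (is_derive_kernel_moment_z k (z - y) s0) hs)).
    by rewrite mulr1.
  - exact: finite_measure_integrable_cst.
  - move=> z y _ _; rewrite /df (le_trans (ler_normB _ _))// lerD//.
      by rewrite normrM ger0_norm// ler_wpM2l// hC.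
    rewrite normrM [X in _ * X]ger0_norm ?invr_ge0 ?(ltW s0)//.
    by apply: ler_wpM2r; [rewrite invr_ge0 ltW|exact: hC'].
apply: (is_derive_eq hd); rewrite /df RintegralB//=.
- rewrite RintegralZl//; last exact: integrable_kernel_moment_shift.
  by rewrite RintegralZr//; exact: integrable_kernel_moment_shift.
- by apply: (integrableZl measurableT k%:R
    (integrable_kernel_moment_shift k.-1 x s0)).
- have := integrableZr measurableT s^-1
    (integrable_kernel_moment_shift k.+1 x s0).
  by [].
Qed.

Lemma is_derive_flow_moment_s k s x : 0 < s ->
  is_derive s 1 (flow_moment k ^~ x)
    (flow_moment k.+2 s x / (2 * s ^+ 2) - flow_moment k s x / (2 * s)).
Proof.
move=> s0; have s20 : 0 < s / 2 by rewrite divr_gt0.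
have ss : s / 2 <= 2 * s by lra.
have [C C0 hC] := kernel_moment_bounded k.+2 s20 ss.
have [C' C'0 hC'] := kernel_moment_bounded k s20 ss.
pose df s y := kernel_moment k.+2 s (x - y) / (2 * s ^+ 2) - kernel_moment k s
  (x - y) / (2 * s).
have hd : is_derive s 1 (flow_moment k ^~ x) (\int[mu]_y df s y).
  apply: (@is_derive_under_integral _ _ _ mu
    (fun s y => kernel_moment k s (x - y)) df
    (cst (C / (2 * (s / 2) ^+ 2) + C' / (2 * (s / 2)))) s (s / 2) (2 * s)).
  - by lra.
  - by lra.
  - by move=> z s2z _; apply: integrable_kernel_moment_shift;
      exact: lt_trans s2z.
  - by move=> z y s2z _; apply: is_derive_kernel_moment_s; exact: lt_trans s2z.
  - exact: finite_measure_integrable_cst.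
  - move=> z y s2z z2s; have z0 : 0 < z by exact: lt_trans s2z.
    rewrite /df (le_trans (ler_normB _ _))// lerD// normrM.
      apply: ler_pM => //; first by rewrite hC// ltW.
      rewrite ger0_norm; last by rewrite invr_ge0 mulr_ge0// sqr_ge0.
      rewrite lef_pV2 ?posrE ?mulr_gt0 ?exprn_gt0// ler_pM2l//.
      by rewrite lerXn2r ?nnegrE ?ltW.
    apply: ler_pM => //; first by rewrite hC'// ltW.
    rewrite ger0_norm; last by rewrite invr_ge0 mulr_ge0// ltW.
    by rewrite lef_pV2 ?posrE ?mulr_gt0// ler_pM2l// ltW.
apply: (is_derive_eq hd); rewrite /df RintegralB//=.
- by rewrite !RintegralZr//; exact: integrable_kernel_moment_shift.
- by have := integrableZr measurableT (2 * s ^+ 2)^-1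
    (integrable_kernel_moment_shift k.+2 x s0).
- by have := integrableZr measurableT (2 * s)^-1
    (integrable_kernel_moment_shift k x s0).
Qed.

Lemma continuous_flow_moment k s : 0 < s -> continuous (flow_moment k s).
Proof.
by move=> s0 x; exact: (is_derive_continuous (is_derive_flow_moment_x k x s0)).
Qed.

Lemma measurable_flow_moment k s : 0 < s ->
  measurable_fun setT (flow_moment k s).
Proof.
by move=> s0; apply: continuous_measurable_fun; exact: continuous_flow_moment.
Qed.

Lemma kernel_moment0 s z : kernel_moment 0 s z = heat_kernel s z.
Proof. by rewrite /kernel_moment expr0 mul1r. Qed.

Lemma integrable_heat_kernel_shift s x : 0 < s ->
  mu.-integrable setT (EFin \o (fun y => heat_kernel s (x - y))).
Proof.
move=> s0; have := integrable_kernel_moment_shift 0 x s0;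
  apply: eq_integrable => //.
by move=> y _ /=; rewrite kernel_moment0.
Qed.

Lemma flow_densityE s x : flow_moment 0 s x = \int[mu]_y heat_kernel s (x - y).
Proof. by apply: eq_Rintegral => y _; rewrite kernel_moment0. Qed.

Lemma flow_density_EFin s x : 0 < s ->
  ((flow_moment 0 s x)%:E = \int[mu]_y (heat_kernel s (x - y))%:E)%E.
Proof.
by move=> s0; rewrite flow_densityE fineK//
  (integrable_fin_num _ (integrable_heat_kernel_shift _ _)).
Qed.

Lemma flow_moment_dom k (a b : R) : 0 < a -> a <= b ->
  exists2 C : R, 0 < C & forall s x, a <= s -> s <= b ->
    `|flow_moment k s x| <= C * flow_moment 0 (2 * b) x.
Proof.
move=> a0 ab; have [C C0 hC] := kernel_moment_dom k a0 ab.
have b0 : 0 < 2 * b by rewrite mulr_gt0// (lt_le_trans a0).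
exists C => // s x h1 h2; have s0 : 0 < s by apply: lt_le_trans h1.
have ik := integrable_kernel_moment_shift k x s0;
  have ih := integrable_heat_kernel_shift x b0.
rewrite (le_trans (le_normr_Rintegral measurableT ik))//.
rewrite flow_densityE -RintegralZl//; apply: le_Rintegral => //.
- by have := integrable_abse ik.
- by have := integrableZl measurableT C ih.
- by move=> y _; exact: hC.
Qed.

Lemma flow_density_ub s x : 0 < s ->
  flow_moment 0 s x <= (Num.sqrt (s * (2 * pi)))^-1.
Proof.
move=> s0; have -> : (Num.sqrt (s * (2 * pi)))^-1 = \int[mu]_y
  (Num.sqrt (s * (2 * pi)))^-1 :> R.
  by rewrite Rintegral_prob_cst.
rewrite flow_densityE; apply: le_Rintegral => //.
- exact: integrable_heat_kernel_shift.
- exact: finite_measure_integrable_cst.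
- by move=> y _; exact: heat_kernel_le.
Qed.

Hypothesis mu2 : mu.-integrable setT (fun y => (y ^+ 2)%:E).

Definition second_moment : R := \int[mu]_y (y ^+ 2).

Lemma second_moment_ge0 : 0 <= second_moment.
Proof. by apply: Rintegral_ge0 => y _; rewrite sqr_ge0. Qed.

(** Jensen's inequality for [exp], after [(x - y)^2 <= 2 (x^2 + y^2)]: the flow
of a measure with two moments never decays faster than a Gaussian. *)
Lemma flow_density_lb s x : 0 < s ->
  (Num.sqrt (s * (2 * pi)))^-1 * expR (- ((x ^+ 2 + second_moment) / s))
    <= flow_moment 0 s x.
Proof.
move=> s0; set P := (Num.sqrt _)^-1; set E := expR _.
have P0 : 0 <= P by rewrite invr_ge0 sqrtr_ge0.
have i1 : mu.-integrable setT
  (EFin \o (fun y => s^-1 * (second_moment - y ^+ 2))).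
  by apply/integrable_cstZ/integrable_sub => //;
    exact: finite_measure_integrable_cst.
have i2 : mu.-integrable setT
  (EFin \o (fun y => 1 + s^-1 * (second_moment - y ^+ 2))).
  by apply: integrable_add => //; exact: finite_measure_integrable_cst.
(* The tangent line of [expR] at the value of the right-hand exponent; its
   integral against [mu] is exactly the tangency value. *)
have -> : P * E = \int[mu]_y (P * E * (1 + s^-1 * (second_moment - y ^+ 2))).
  rewrite RintegralZl// RintegralD//; last exact: finite_measure_integrable_cst.
  rewrite Rintegral_prob_cst RintegralZl//; last first.
    by apply: integrable_sub => //; exact: finite_measure_integrable_cst.
  rewrite RintegralB//; last exact: finite_measure_integrable_cst.
  by rewrite Rintegral_prob_cst subrr mulr0 addr0 mulr1.
rewrite flow_densityE; apply: le_Rintegral => //.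
- by have := integrableZl measurableT (P * E) i2.
- exact: integrable_heat_kernel_shift.
move=> y _; rewrite /heat_kernel -/P -mulrA; apply: ler_wpM2l => //.
apply: (le_trans (ler_wpM2l (expR_ge0 _) (expR_ge1Dx _))).
rewrite -expRD ler_expR.
have -> : - ((x ^+ 2 + second_moment) / s) + s^-1 * (second_moment - y ^+ 2)
  = - ((x ^+ 2 + y ^+ 2) / s).
  by ring.
rewrite lerN2 invfM mulrA; apply: ler_wpM2r; first by rewrite invr_ge0 ltW.
by have := sqr_ge0 (x + y); lra.
Qed.

Lemma flow_density_gt0 s x : 0 < s -> 0 < flow_moment 0 s x.
Proof.
move=> s0; apply: lt_le_trans (flow_density_lb x s0).
by rewrite mulr_gt0 ?expR_gt0// invr_gt0 sqrtr_gt0 !mulr_gt0// pi_gt0.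
Qed.

Lemma ln_flow_density_bound (a b : R) : 0 < a -> a <= b ->
  exists2 C : R, 0 < C & forall s x, a <= s -> s <= b ->
    `|ln (flow_moment 0 s x)| <= C * (1 + x ^+ 2).
Proof.
move=> a0 ab; pose P s : R := (Num.sqrt (s * (2 * pi)))^-1.
have b0 : 0 < b by apply: lt_le_trans ab.
have P0 s : 0 < s -> 0 < P s.
  by move=> s0; rewrite invr_gt0 sqrtr_gt0 !mulr_gt0// pi_gt0.
have Pmono s t : 0 < s -> s <= t -> P t <= P s.
  move=> s0 st; rewrite lef_pV2 ?posrE ?sqrtr_gt0 ?mulr_gt0 ?pi_gt0//;
    last exact: lt_le_trans st.
  by rewrite ler_wsqrtr// ler_wpM2r// ltW// mulr_gt0// pi_gt0.
have m0 := second_moment_ge0.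
exists (`|ln (P a)| + `|ln (P b)| + (1 + second_moment) / a).
  by rewrite ltr_wpDl ?addr_ge0// divr_gt0// ltr_pwDl.
move=> s x as_ sb; have s0 : 0 < s by apply: lt_le_trans as_.
have f0 := flow_density_gt0 x s0.
have ub : ln (flow_moment 0 s x) <= ln (P a).
  by rewrite ler_ln ?posrE ?P0// (le_trans (flow_density_ub x s0))// Pmono.
have lb : ln (P b) - (x ^+ 2 + second_moment) / a <= ln (flow_moment 0 s x).
  apply: (@le_trans _ _ (ln (P s * expR (- ((x ^+ 2 + second_moment) / s))))).
    rewrite lnM ?posrE ?P0 ?expR_gt0// expRK; apply: lerD.
      by rewrite ler_ln ?posrE ?P0// Pmono.
    by rewrite lerN2 ler_wpM2l ?addr_ge0 ?sqr_ge0// lef_pV2 ?posrE.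
  by rewrite ler_ln ?posrE ?mulr_gt0 ?P0 ?expR_gt0//; exact: flow_density_lb.
have h : (x ^+ 2 + second_moment) / a <= (1 + second_moment) / a * (1 + x ^+ 2).
  rewrite mulrAC; apply: ler_wpM2r; first by rewrite invr_ge0 ltW.
  by have := sqr_ge0 x; nra.
have := ler_norm (ln (P a)); have := ler_norm (- ln (P b));
  rewrite normrN => hb ha.
have := normr_ge0 (ln (P a)); have := normr_ge0 (ln (P b)) => pb pa.
have x0 := sqr_ge0 x.
set D := (1 + second_moment) / a in h *.
have hA := mulr_ge0 pa x0; have hB := mulr_ge0 pb x0.
have hD : 0 <= D * (1 + x ^+ 2).
  by rewrite mulr_ge0 ?addr_ge0// divr_ge0 ?addr_ge0// ltW.
rewrite ler_norml; apply/andP; split; lra.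
Qed.

(** Up to the factor [- 1 / s] the ratio [M_1 / M_0] is the score [d_x ln f].  The
part [|z| <= rad] of the integral costs a factor [rad]; on the rest, the Gaussian
tail beyond [rad] is smaller than [flow_density_lb] when [rad] is of order
[1 + |x|]. *)
Lemma flow_moment1_ratio (a b : R) : 0 < a -> a <= b ->
  exists2 C : R, 0 < C & forall s x, a <= s -> s <= b ->
    `|flow_moment 1 s x| <= C * (1 + `|x|) * flow_moment 0 s x.
Proof.
move=> a0 ab; have m0 := second_moment_ge0;
  have b0 : 0 < b by apply: lt_le_trans ab.
exists (2 + 2 * second_moment + (b + 1) + 1); first by lra.
move=> s x as_ sb; have s0 : 0 < s by apply: lt_le_trans as_.
(* [rad ^+ 2 / (4 * s)] dominates the exponent [(x ^+ 2 + second_moment) / s] of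
   [flow_density_lb], as [second_moment <= (1 + second_moment) ^+ 2]. *)
pose rad := 2 * (`|x| + (1 + second_moment)).
have rad0 : 0 <= rad by have := normr_ge0 x; rewrite /rad; lra.
set P := (Num.sqrt (s * (2 * pi)))^-1.
have P0 : 0 < P by rewrite invr_gt0 sqrtr_gt0 !mulr_gt0// pi_gt0.
pose tail := P * (s + 1) * expR (- (rad ^+ 2 / (4 * s))).
have tail0 : 0 <= tail by rewrite mulr_ge0 ?expR_ge0// mulr_ge0 ?(ltW P0)//
  addr_ge0// ltW.
have pw z : `|kernel_moment 1 s z| <= rad * heat_kernel s z + tail.
  rewrite /kernel_moment expr1 normrM (gtr0_norm (heat_kernel_gt0 z s0)).
  have [zr|rz] := leP `|z| rad.
    by rewrite ler_wpDr// ler_wpM2r// ltW// heat_kernel_gt0.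
  apply: ler_wpDl; first by rewrite mulr_ge0// ltW// heat_kernel_gt0.
  have -> : heat_kernel s z = P *
    (expR (- (z ^+ 2 / (4 * s))) * expR (- (z ^+ 2 / (4 * s)))).
    rewrite /heat_kernel -/P -expRD; congr (_ * expR _).
    by field; rewrite gt_eqF.
  rewrite mulrCA /tail -mulrA; apply: ler_wpM2l; first exact: ltW.
  rewrite mulrA; apply: ler_pM.
  - by rewrite mulr_ge0 ?expR_ge0.
  - exact: expR_ge0.
  - rewrite expRN ler_pdivrMr ?expR_gt0//.
    apply: (@le_trans _ _ ((s + 1) * (1 + z ^+ 2 / (4 * s)))); last first.
      by apply: ler_wpM2l; [rewrite addr_ge0// ltW|exact: expR_ge1Dx].
    have -> : (s + 1) * (1 + z ^+ 2 / (4 * s)) = s + 1 + z ^+ 2 / 4 + z ^+ 2 /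
      (4 * s).
      by field; rewrite gt_eqF.
    have : 0 <= z ^+ 2 / (4 * s) by rewrite divr_ge0 ?sqr_ge0// mulr_ge0// ltW.
    rewrite -(real_normK (num_real z)).
    by have := sqr_ge0 (`|z| - 2); have := normr_ge0 z; lra.
  - rewrite ler_expR lerN2; apply: ler_wpM2r;
      first by rewrite invr_ge0 mulr_ge0// ltW.
    by rewrite -(real_normK (num_real z)) lerXn2r ?nnegrE// ltW.
have tail_le : tail <= (s + 1) * flow_moment 0 s x.
  rewrite /tail mulrAC mulrC; apply: ler_wpM2l; first by rewrite addr_ge0// ltW.
  apply: le_trans (flow_density_lb x s0); rewrite -/P; apply: ler_wpM2l;
    first exact: ltW.
  rewrite ler_expR lerN2.
  have -> : rad ^+ 2 / (4 * s) = (`|x| + (1 + second_moment)) ^+ 2 / s.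
    by rewrite /rad; field; rewrite gt_eqF.
  apply: ler_wpM2r; first by rewrite invr_ge0 ltW.
  rewrite -(real_normK (num_real x)); have := normr_ge0 x; nra.
have f0 := flow_density_gt0 x s0.
have ik := integrable_kernel_moment_shift 1 x s0;
  have ih := integrable_heat_kernel_shift x s0.
have ir : mu.-integrable setT (EFin \o (fun y => rad * heat_kernel s (x - y))).
  by have := integrableZl measurableT rad ih.
have ic : mu.-integrable setT (EFin \o (cst tail))
  by exact: finite_measure_integrable_cst.
have h1 : `|flow_moment 1 s x| <= rad * flow_moment 0 s x + tail.
  rewrite (le_trans (le_normr_Rintegral measurableT ik))//.
  apply: (@le_trans _ _ (\int[mu]_y (rad * heat_kernel s (x - y) + tail))).
    apply: le_Rintegral; first by [].
    - by have := integrable_abse ik.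
    - by have := integrableD measurableT ir ic.
    - by move=> y _; exact: pw.
  rewrite RintegralD// RintegralZl// -flow_densityE.
  by rewrite Rintegral_prob_cst.
apply: (le_trans h1); apply: (@le_trans _ _
  ((rad + (s + 1)) * flow_moment 0 s x)).
  by rewrite mulrDl lerD2l.
apply: ler_wpM2r; first exact: ltW.
rewrite /rad; have := normr_ge0 x; nra.
Qed.

(** A weight at [x] is paid for by weights at [y] and at [x - y], separating the
contributions of [mu] and of the kernel. *)
Lemma sqr_split x y : 1 + x ^+ 2 <= 2 * (1 + y ^+ 2) * (1 + (x - y) ^+ 2).
Proof. have := sqr_ge0 (x - 2 * y); have := sqr_ge0 (y * (x - y)); nra. Qed.

Lemma heat_kernel_weight_dom s : 0 < s ->
  exists2 C : R, 0 < C & forall x y, (1 + x ^+ 2) * heat_kernel s (x - y) <= C *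
    (1 + y ^+ 2) * heat_kernel (2 * s) (x - y).
Proof.
move=> s0; have [C C0 hC] := kernel_moment_dom 2 s0 (lexx s).
have [C' C'0 hC'] := kernel_moment_dom 0 s0 (lexx s).
exists (2 * (C + C')); first by rewrite mulr_gt0// addr_gt0.
move=> x y; apply: (le_trans
  (ler_wpM2r (ltW (heat_kernel_gt0 _ s0)) (sqr_split x y))).
have -> : 2 * (C + C') * (1 + y ^+ 2) * heat_kernel (2 * s) (x - y) =
    2 * (1 + y ^+ 2) * ((C + C') * heat_kernel (2 * s) (x - y)) by ring.
have -> : 2 * (1 + y ^+ 2) * (1 + (x - y) ^+ 2) * heat_kernel s (x - y) =
    2 * (1 + y ^+ 2) * ((1 + (x - y) ^+ 2) * heat_kernel s (x - y)) by ring.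
apply: ler_wpM2l; first by rewrite mulr_ge0// addr_ge0// sqr_ge0.
rewrite mulrDl mul1r [X in _ <= X]mulrDl addrC; apply: lerD.
  by apply: le_trans (hC _ (x - y) (lexx s) (lexx s)); exact: ler_norm.
by apply: le_trans (hC' _ (x - y) (lexx s) (lexx s));
  rewrite kernel_moment0 ler_norm.
Qed.

Lemma integrable_1sqr : mu.-integrable setT (EFin \o (fun y => 1 + y ^+ 2)).
Proof.
by apply: integrable_add => //; exact: finite_measure_integrable_cst.
Qed.

Lemma measurable_heat_kernel_sub s : 0 < s ->
  measurable_fun setT (fun z : R * R => heat_kernel s (z.1 - z.2)).
Proof.
move=> s0; have mh : measurable_fun setT (heat_kernel s).
  have := measurable_kernel_moment 0 s0; apply: eq_measurable_fun => z _.
  by rewrite kernel_moment0.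
by apply: (measurableT_comp mh); exact: measurable_funB.
Qed.

End heat_flow.

(** * Integrability and decay of the flow *)

Section heat_flow_tails.
Context {R : realType}.
Variable mu : probability R R.
Implicit Types (s x y z : R) (k : nat).
Local Notation flow_moment := (flow_moment mu).

Hypothesis mu2 : mu.-integrable setT (fun y => (y ^+ 2)%:E).

(** By Tonelli's theorem the integral is at most a multiple of the integral of
[1 + y^2] against [mu]. *)
Lemma integrable_flow_density s : 0 < s ->
  lebesgue_measure.-integrable setT
    (EFin \o (fun x => (1 + x ^+ 2) * flow_moment 0 s x)).
Proof.
move=> s0; have [C C0 hC] := heat_kernel_weight_dom s0.
have s20 : 0 < 2 * s by rewrite mulr_gt0.
have msq : measurable_fun setT (fun x : R => 1 + x ^+ 2).
  by apply: measurable_funD => //; exact: measurable_funX.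
apply/integrableP; split.
  by apply/measurable_EFinP; apply: measurable_funM => //;
    exact: measurable_flow_moment.
have mh z : measurable_fun setT (fun y => heat_kernel s (z - y)).
  by have := measurable_kernel_moment_shift 0 z s0;
    apply: eq_measurable_fun => y _; rewrite kernel_moment0.
under eq_integral => x _.
  rewrite /= ger0_norm; last first.
    by rewrite mulr_ge0 ?(ltW (flow_density_gt0 mu2 x s0))// addr_ge0// sqr_ge0.
  rewrite EFinM flow_density_EFin// -ge0_integralZl//; last 3 first.
  - exact/measurable_EFinP.
  - by move=> y _; rewrite lee_fin ltW// heat_kernel_gt0.
  - by rewrite lee_fin addr_ge0// sqr_ge0.
  over.
pose h (z : measurableTypeR R * R) : \bar R :=
  ((1 + z.1 ^+ 2) * heat_kernel s (z.1 - z.2))%:E.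
have mJ : measurable_fun setT h.
  apply/measurable_EFinP; apply: measurable_funM;
    last exact: measurable_heat_kernel_sub.
  by apply: (measurableT_comp msq).
have J0 (w : measurableTypeR R * R) : (0 <= h w)%E.
  by rewrite lee_fin mulr_ge0 ?(ltW (heat_kernel_gt0 _ s0))// addr_ge0//
    sqr_ge0.
rewrite /= (@fubini_tonelli _ _ _ _ _ lebesgue_measure mu h)//.
apply: (@le_lt_trans _ _ (\int[mu]_y (C%:E * (1 + y ^+ 2)%:E))%E).
  apply: ge0_le_integral => //=.
  - by move=> y _; apply: integral_ge0 => x _;
      rewrite lee_fin mulr_ge0 ?(ltW (heat_kernel_gt0 _ s0))// addr_ge0//
      sqr_ge0.
  - have hG := measurable_fun_fubini_tonelli_G (m1 := lebesgue_measure) h mJ J0.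
    exact: hG.
  - by apply: measurable_funeM; exact/measurable_EFinP.
  move=> y _; have mhy t : 0 < t ->
    measurable_fun setT (fun x => heat_kernel t (x - y)).
    move=> t0; apply: (measurableT_comp _ (measurable_funB _ _)) => //.
    by have := measurable_kernel_moment 0 t0; apply: eq_measurable_fun => z _;
      rewrite kernel_moment0.
  rewrite -[leRHS]mule1 -(integral_heat_kernel_shift y s20) -EFinM
    -ge0_integralZl//; last 3 first.
  - by apply/measurable_EFinP; exact: mhy.
  - by move=> x _; rewrite lee_fin ltW// heat_kernel_gt0.
  - by rewrite lee_fin mulr_ge0 ?(ltW C0)// addr_ge0// sqr_ge0.
  apply: ge0_le_integral => //=.
  - by apply/measurable_EFinP; apply: measurable_funM => //; exact: mhy.
  - by apply: measurable_funeM; apply/measurable_EFinP; exact: mhy.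
  - by move=> x _; rewrite lee_fin.
rewrite ge0_integralZl//=; last 3 first.
- exact/measurable_EFinP.
- by move=> y _; rewrite lee_fin addr_ge0// sqr_ge0.
- by rewrite lee_fin ltW.
rewrite lte_mul_pinfty// ?lee_fin ?(ltW C0)//.
have /integrableP[_] := (integrable_1sqr mu2).
by under eq_integral => y _ do rewrite /= ger0_norm ?addr_ge0 ?sqr_ge0//.
Qed.

(** A second moment gives no rate, only convergence: for fixed [y] the integrand
tends to [0], and it is dominated by a multiple of [1 + y^2]. *)
Lemma flow_density_decay s (u : nat -> R) : 0 < s ->
  (forall n, `|u n| = n%:R) ->
  (1 + u n ^+ 2) * flow_moment 0 s (u n) @[n --> \oo] --> 0.
Proof.
move=> s0 uE; have [C C0 hC] := heat_kernel_weight_dom s0.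
have s20 : 0 < 2 * s by rewrite mulr_gt0.
have [C' C'0 hC'] := heat_kernel_weight_dom s20.
pose P := (Num.sqrt (2 * s * (2 * pi)))^-1 : R.
pose P' := (Num.sqrt (2 * (2 * s) * (2 * pi)))^-1 : R.
pose f n y := (1 + u n ^+ 2) * heat_kernel s (u n - y).
have q0 x : 0 <= 1 + x ^+ 2 by rewrite addr_ge0// sqr_ge0.
have f0 n y : 0 <= f n y by rewrite mulr_ge0// ltW// heat_kernel_gt0.
have mf n : measurable_fun setT (f n).
  apply: measurable_funM => //.
  by have := measurable_kernel_moment_shift 0 (u n) s0;
    apply: eq_measurable_fun => y _; rewrite kernel_moment0.
have lim0 y : f n y @[n --> \oo] --> 0.
  pose K := C * (1 + y ^+ 2) * (C' * (1 + y ^+ 2) * P').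
  apply: (@squeeze_cvgr _ _ _ _ (cst 0) (fun n => K * n.+1%:R^-1)).
  - near=> n; rewrite f0/=; apply: (le_trans (hC _ _)).
    have -> : K * n.+1%:R^-1 = C * (1 + y ^+ 2) *
      (C' * (1 + y ^+ 2) * P' * n.+1%:R^-1).
      by rewrite /K; ring.
    apply: ler_wpM2l; first by rewrite mulr_ge0// ltW.
    rewrite -/P ler_pdivlMr// mulrC.
    apply: (@le_trans _ _ ((1 + u n ^+ 2) * heat_kernel (2 * s) (u n - y))).
      apply: ler_wpM2r; first by rewrite ltW// heat_kernel_gt0.
      rewrite -(real_normK (num_real (u n))) uE -natr1 addrC lerD2l.
      have : 1 <= n%:R :> R by rewrite ler1n; near: n; exists 1%N.
      by nra.
    apply: (le_trans (hC' _ _)); apply: ler_wpM2l;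
      first by rewrite mulr_ge0// ltW.
    by apply: heat_kernel_le; rewrite mulr_gt0.
  - exact: cvg_cst.
  - rewrite -[X in _ --> X](mulr0 K); apply: cvgM; first exact: cvg_cst.
    exact: cvg_harmonic.
pose G y := C * P * (1 + y ^+ 2).
have iG : mu.-integrable setT (EFin \o G).
  by have := integrableZl measurableT (C * P) (integrable_1sqr mu2).
have fG n y : `|f n y| <= G y.
  rewrite ger0_norm// /f /G mulrAC; apply: (le_trans (hC _ _)).
  by apply: ler_wpM2l; [rewrite mulr_ge0// ltW|exact: heat_kernel_le].
have -> : (fun n => (1 + u n ^+ 2) * flow_moment 0 s (u n))
  = (fun n => \int[mu]_y f n y).
  apply/funext => n; rewrite flow_densityE -RintegralZl//;
    exact: integrable_heat_kernel_shift.
rewrite -[X in _ --> X](Rintegral_prob_cst mu).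
apply: (cvg_Rintegral_dominated mf lim0 _ iG fG).
exact: finite_measure_integrable_cst.
Unshelve. all: end_near. Qed.

End heat_flow_tails.

(** * De Bruijn's identity *)

Section integral_of_derivative.
Context {R : realType}.
Local Notation leb := (@lebesgue_measure R).

Lemma Rintegral_derivative_eq0 (U D : R -> R) :
  (forall x : R, is_derive x 1 U (D x)) -> continuous D ->
  leb.-integrable setT (EFin \o D) ->
  U n%:R @[n --> \oo] --> 0 -> U (- n%:R) @[n --> \oo] --> 0 ->
  \int[leb]_x D x = 0.
Proof.
move=> dU cD iD Up Um.
(* [n.+1] keeps the interval nondegenerate at [n = 0]. *)
pose I n : set R := `[- n.+1%:R, n.+1%:R]%classic.
pose F n : R -> R := D \_ (I n).
have cU : continuous U by move=> x; exact: (is_derive_continuous (dU x)).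
have FE n : \int[leb]_x F n x = U n.+1%:R - U (- n.+1%:R).
  rewrite -Rintegral_mkcond /Rintegral (@continuous_FTC2 _ D U)//.
  - by rewrite -subr_gt0 opprK addr_gt0.
  - exact: continuous_subspaceT.
  - split.
    + by move=> x _; have [] := dU x.
    + exact/cvg_at_right_filter/cU.
    + exact/cvg_at_left_filter/cU.
  - by move=> x _; rewrite derive1E; have [_ ->] := dU x.
have mD : measurable_fun setT D by exact: continuous_measurable_fun.
have lim1 : \int[leb]_x F n x @[n --> \oo] --> \int[leb]_x D x.
  apply: (@cvg_Rintegral_dominated _ _ _ leb F D (fun x => `|D x|)) => //.
  - move=> n; apply/(measurable_restrictT _ _).1 => //.
      exact: measurable_itv.
    exact: measurable_funTS.
  - move=> x; apply/cvgrPdist_le => e e0.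
    near=> n; rewrite /F patchE ifT ?subrr ?normr0 ?ltW// inE /I/= in_itv/=.
    rewrite -ler_norml (@le_trans _ _ n%:R) ?ler_nat//.
    by near: n; exact: nbhs_infty_ger.
  - by have := integrable_abse iD.
  - by move=> n x; rewrite /F patchE; case: ifPn => // _; rewrite normr0.
have lim0 : \int[leb]_x F n x @[n --> \oo] --> 0.
  have -> : (fun n => \int[leb]_x F n x) = (fun n => U n.+1%:R - U (- n.+1%:R)).
    exact/funext/FE.
  rewrite -[X in _ --> X](subr0 (0 : R)); apply: cvgB.
    by move: Up; rewrite -(cvg_shiftS (fun n => U n%:R)).
  by move: Um; rewrite -(cvg_shiftS (fun n => U (- n%:R))).
exact: (cvg_unique _ lim1 lim0).
Unshelve. all: end_near. Qed.

End integral_of_derivative.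

Section entropy_fisher.
Context {R : realType}.
Variable mu : probability R R.
Implicit Types (s x y z : R) (k : nat).
Hypothesis mu2 : mu.-integrable setT (fun y => (y ^+ 2)%:E).
Local Notation flow_moment := (flow_moment mu).
Local Notation leb := (@lebesgue_measure R).

(** The time derivative of the density, which is also half of its second space
derivative. *)
Definition flow_density_dot s x : R := flow_moment 2 s x / (2 * s ^+ 2)
  - flow_moment 0 s x / (2 * s).
(** [(d_x f)^2 / f], as [d_x f = - M_1 / s]. *)
Definition score_density s x : R := flow_moment 1 s x ^+ 2 /
  (s ^+ 2 * flow_moment 0 s x).
Definition flow_entropy s : R := - \int[leb]_x
  (flow_moment 0 s x * ln (flow_moment 0 s x)).
Definition flow_fisher s : R := \int[leb]_x score_density s x.

Lemma integrable_weighted (F : R -> R) (K b : R) : 0 < b ->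
  measurable_fun setT F ->
  (forall x, `|F x| <= K * ((1 + x ^+ 2) * flow_moment 0 b x)) ->
  leb.-integrable setT (EFin \o F).
Proof.
move=> b0 mF.
apply: (@integrable_dominated _ _ _ leb F
  (fun x => K * ((1 + x ^+ 2) * flow_moment 0 b x))) => //.
exact/integrable_cstZ/(integrable_flow_density mu2).
Qed.

Lemma continuous_ln_flow_density s : 0 < s ->
  continuous (fun x => ln (flow_moment 0 s x)).
Proof.
move=> s0 x; apply: continuous_comp; first exact: continuous_flow_moment.
by apply: continuous_ln; exact: flow_density_gt0.
Qed.

Lemma continuous_flow_density_dot s : 0 < s -> continuous (flow_density_dot s).
Proof.
move=> s0 x; apply: cvgB; apply: cvgM;
  by [exact: continuous_flow_moment|exact: cvg_cst].
Qed.

Lemma continuous_score_density s : 0 < s -> continuous (score_density s).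
Proof.
move=> s0 x; apply: cvgM.
  by rewrite expr2; apply: cvgM; exact: continuous_flow_moment.
apply: cvgV; first by rewrite mulf_neq0 ?expf_neq0 ?gt_eqF// flow_density_gt0.
by apply: cvgM; [exact: cvg_cst|exact: continuous_flow_moment].
Qed.

Lemma le_weight1 x : 1 + `|x| <= 2 * (1 + x ^+ 2).
Proof.
by rewrite -(real_normK (num_real x)); have := sqr_ge0 (`|x| - 1); nra.
Qed.

Lemma le_weight2 x : (1 + `|x|) ^+ 2 <= 2 * (1 + x ^+ 2).
Proof.
by rewrite -(real_normK (num_real x)); have := sqr_ge0 (`|x| - 1); nra.
Qed.

Lemma weight_ge1 x : 1 <= 1 + x ^+ 2.
Proof. by rewrite lerDl sqr_ge0. Qed.

Lemma flow_density_dot_dom (a b : R) : 0 < a -> a <= b ->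
  exists2 C : R, 0 < C & forall s x, a <= s -> s <= b ->
    `|flow_density_dot s x| <= C * flow_moment 0 (2 * b) x.
Proof.
move=> a0 ab.
have [C C0 hC] := flow_moment_dom mu 2 a0 ab.
have [C' C'0 hC'] := flow_moment_dom mu 0 a0 ab.
have a20 : 0 < 2 * a by rewrite mulr_gt0.
have aa0 : 0 < 2 * a ^+ 2 by rewrite mulr_gt0// exprn_gt0.
exists (C / (2 * a ^+ 2) + C' / (2 * a)); first by rewrite addr_gt0// divr_gt0.
move=> s x as_ sb; have s0 : 0 < s by apply: lt_le_trans as_.
have s20 : 0 < 2 * s by rewrite mulr_gt0.
have ss0 : 0 < 2 * s ^+ 2 by rewrite mulr_gt0// exprn_gt0.
rewrite (le_trans (ler_normB _ _))// [X in _ <= X]mulrDl; apply: lerD;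
  rewrite normrM [X in _ <= X]mulrAC.
  apply: ler_pM => //; first exact: hC.
  rewrite ger0_norm ?invr_ge0 ?(ltW ss0)// lef_pV2 ?posrE// ler_pM2l//.
  by rewrite lerXn2r ?nnegrE// ltW.
apply: ler_pM => //; first exact: hC'.
by rewrite ger0_norm ?invr_ge0 ?(ltW s20)// lef_pV2 ?posrE// ler_pM2l.
Qed.

Lemma entropy_density_dom (a b : R) : 0 < a -> a <= b ->
  exists2 K : R, 0 < K & forall s x, a <= s -> s <= b ->
    `|flow_moment 0 s x * ln (flow_moment 0 s x)| <= K *
      ((1 + x ^+ 2) * flow_moment 0 (2 * b) x).
Proof.
move=> a0 ab.
have [C C0 hC] := flow_moment_dom mu 0 a0 ab.
have [L L0 hL] := ln_flow_density_bound mu2 a0 ab.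
exists (C * L); first by rewrite mulr_gt0.
move=> s x as_ sb; rewrite normrM.
have -> : C * L * ((1 + x ^+ 2) * flow_moment 0 (2 * b) x) =
  C * flow_moment 0 (2 * b) x * (L * (1 + x ^+ 2)) by ring.
by apply: ler_pM => //; [exact: hC|exact: hL].
Qed.

Lemma entropy_density_der_dom (a b : R) : 0 < a -> a <= b ->
  exists2 K : R, 0 < K & forall s x, a <= s -> s <= b ->
    `|flow_density_dot s x * (ln (flow_moment 0 s x) + 1)| <= K *
      ((1 + x ^+ 2) * flow_moment 0 (2 * b) x).
Proof.
move=> a0 ab.
have [C C0 hC] := flow_density_dot_dom a0 ab.
have [L L0 hL] := ln_flow_density_bound mu2 a0 ab.
exists (C * (L + 1)); first by rewrite mulr_gt0// addr_gt0.
move=> s x as_ sb; rewrite normrM.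
have -> : C * (L + 1) * ((1 + x ^+ 2) * flow_moment 0 (2 * b) x) =
  C * flow_moment 0 (2 * b) x * ((L + 1) * (1 + x ^+ 2)) by ring.
apply: ler_pM => //; first exact: hC.
rewrite (le_trans (ler_normD _ _))// mulrDl mul1r normr1; apply: lerD;
  first exact: hL.
exact: weight_ge1.
Qed.

(** One factor [M_1] is bounded by the wider density, the other one, divided by
[M_0], by [flow_moment1_ratio]. *)
Lemma score_density_dom (a b : R) : 0 < a -> a <= b ->
  exists2 K : R, 0 < K & forall s x, a <= s -> s <= b ->
    `|score_density s x| <= K * ((1 + x ^+ 2) * flow_moment 0 (2 * b) x).
Proof.
move=> a0 ab.
have [C C0 hC] := flow_moment_dom mu 1 a0 ab.
have [L L0 hL] := flow_moment1_ratio mu2 a0 ab.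
have aa0 : 0 < a ^+ 2 by rewrite exprn_gt0.
exists (2 * L * C / a ^+ 2); first by rewrite divr_gt0// !mulr_gt0.
move=> s x as_ sb; have s0 : 0 < s by apply: lt_le_trans as_.
have b0 : 0 < 2 * b by rewrite mulr_gt0// (lt_le_trans a0).
have f0 := flow_density_gt0 mu2 x s0; have g0 := flow_density_gt0 mu2 x b0.
rewrite /score_density expr2 normrM invfM normrM [`|(s ^+ 2)^-1 * _|]normrM.
have -> : 2 * L * C / a ^+ 2 * ((1 + x ^+ 2) * flow_moment 0 (2 * b) x) =
  (C * flow_moment 0 (2 * b) x) * ((a ^+ 2)^-1 * (L * (2 * (1 + x ^+ 2))))
    by ring.
rewrite -mulrA; apply: ler_pM => //; first exact: hC.
rewrite mulrCA; apply: ler_pM => //.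
- rewrite ger0_norm ?invr_ge0 ?sqr_ge0// lef_pV2 ?posrE ?exprn_gt0//.
  by rewrite lerXn2r ?nnegrE// ltW.
- rewrite [`|_^-1|]ger0_norm ?invr_ge0 ?(ltW f0)// ler_pdivrMr//.
  apply: (le_trans (hL s x as_ sb)); apply: ler_wpM2r; first exact: ltW.
  by apply: ler_wpM2l; [exact: ltW|exact: le_weight1].
Qed.

(** The time derivative of [score_density], by the quotient rule. *)
Definition score_density_dot s x : R :=
  2 * flow_moment 1 s x * (flow_moment 3 s x / (2 * s ^+ 2) - flow_moment 1 s x
    / (2 * s)) / (s ^+ 2 * flow_moment 0 s x)
  - flow_moment 1 s x ^+ 2 *
      (2 * s * flow_moment 0 s x + s ^+ 2 * flow_density_dot s x) /
      (s ^+ 2 * flow_moment 0 s x) ^+ 2.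

Lemma is_derive_score_density s x : 0 < s ->
  is_derive s 1 (score_density ^~ x) (score_density_dot s x).
Proof.
move=> s0; have f0 := flow_density_gt0 mu2 x s0.
have n0 : s ^+ 2 * flow_moment 0 s x != 0 by rewrite gt_eqF// mulr_gt0//
  exprn_gt0.
have d0 := is_derive_flow_moment_s mu 0 x s0.
have d1 := is_derive_flow_moment_s mu 1 x s0.
have dn := is_deriveM_fun (is_deriveX_fun 2 (is_derive_id_fun s)) d0.
have dv := is_deriveV_fun (f := fun s => s ^+ 2 * flow_moment 0 s x) n0 dn.
apply: (is_derive_eq (is_deriveM_fun (is_deriveX_fun 2 d1) dv)).
rewrite /score_density_dot -/(flow_density_dot s x) /=;
  set D1 := flow_moment 3 s x / _ - _.
by field; rewrite gt_eqF//= gt_eqF.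
Qed.

(** Written with [rho = M_1 / M_0], the derivative is quadratic in [rho] and linear
in the remaining [M_k]; as [rho] grows at most linearly in [x], the weight
[1 + x^2] suffices. *)
Lemma score_density_dot_dom (a b : R) : 0 < a -> a <= b ->
  exists2 K : R, 0 < K & forall s x, a <= s -> s <= b ->
    `|score_density_dot s x| <= K * ((1 + x ^+ 2) * flow_moment 0 (2 * b) x).
Proof.
move=> a0 ab.
have [C C0 hC] := flow_moment_dom mu 1 a0 ab.
have [C' C'0 hC'] := flow_moment_dom mu 3 a0 ab.
have [E E0 hE] := flow_density_dot_dom a0 ab.
have [L L0 hL] := flow_moment1_ratio mu2 a0 ab.
have aa0 : 0 < a ^+ 2 by rewrite exprn_gt0.
pose ia := a^-1.
have ia0 : 0 < ia by rewrite invr_gt0.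
pose K3 := 2 * L * (ia ^+ 4 * C') + 2 * L * (3 * ia ^+ 3 * C) + 2 * (L * L) *
  (ia ^+ 2 * E).
exists K3.
  by rewrite /K3 !addr_gt0// !mulr_gt0// ?exprn_gt0// !mulr_gt0// exprn_gt0.
move=> s x as_ sb; have s0 : 0 < s by apply: lt_le_trans as_.
have b0 : 0 < 2 * b by rewrite mulr_gt0// (lt_le_trans a0).
have f0 := flow_density_gt0 mu2 x s0; have g0 := flow_density_gt0 mu2 x b0.
pose rho := flow_moment 1 s x / flow_moment 0 s x.
pose inv_s := s^-1.
have inv_s_ge0 : 0 <= inv_s by rewrite invr_ge0 ltW.
have inv_s_le : inv_s <= ia by rewrite lef_pV2 ?posrE.
have inv_sX n : `|inv_s ^+ n| <= ia ^+ n.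
  by rewrite ger0_norm ?exprn_ge0// lerXn2r ?nnegrE// ltW.
(* [rho] collects the only denominators [M_0]. *)
have -> : score_density_dot s x =
    rho * (inv_s ^+ 4 * flow_moment 3 s x) - rho *
      (3 * inv_s ^+ 3 * flow_moment 1 s x)
    - rho ^+ 2 * (inv_s ^+ 2 * flow_density_dot s x).
  rewrite /score_density_dot /rho /inv_s; set h := flow_density_dot s x.
  by field; rewrite gt_eqF//= gt_eqF.
set w := 1 + x ^+ 2; have w1 : 1 <= w by exact: weight_ge1.
set gb := flow_moment 0 (2 * b) x in g0 *.
have hrho : `|rho| <= L * (1 + `|x|).
  by rewrite normrM [`|_^-1|]ger0_norm ?invr_ge0 ?(ltW f0)// ler_pdivrMr// hL.
have hrho1 : `|rho| <= 2 * L * w.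
  by rewrite (le_trans hrho)// [2 * L]mulrC -mulrA ler_wpM2l ?(ltW L0)//
    le_weight1.
have hrho2 : `|rho ^+ 2| <= 2 * (L * L) * w.
  rewrite normrX (@le_trans _ _ ((L * (1 + `|x|)) ^+ 2))//.
    by rewrite lerXn2r ?nnegrE// mulr_ge0 ?addr_ge0// ltW.
  have -> : 2 * (L * L) * w = L ^+ 2 * (2 * w) by ring.
  rewrite exprMn; apply: ler_wpM2l; first exact: sqr_ge0.
  exact: le_weight2.
have -> : K3 * (w * gb) = 2 * L * w * (ia ^+ 4 * (C' * gb)) + 2 * L * w *
  (3 * ia ^+ 3 * (C * gb))
    + 2 * (L * L) * w * (ia ^+ 2 * (E * gb)) by rewrite /K3; ring.
rewrite (le_trans (ler_normB _ _))//; apply: lerD.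
  rewrite (le_trans (ler_normB _ _))//; apply: lerD; rewrite normrM.
    by apply: ler_pM => //; rewrite normrM; apply: ler_pM => //; exact: hC'.
  apply: ler_pM => //; rewrite normrM; apply: ler_pM => //; last exact: hC.
  by rewrite normrM ger0_norm// ler_pM2l.
rewrite normrM; apply: ler_pM => //; rewrite normrM; apply: ler_pM => //;
  exact: hE.
Qed.

Lemma integrable_entropy_density s : 0 < s ->
  leb.-integrable setT (EFin \o
    (fun x => flow_moment 0 s x * ln (flow_moment 0 s x))).
Proof.
move=> s0; have [K K0 hK] := entropy_density_dom s0 (lexx s).
apply: (@integrable_weighted _ K (2 * s)); first by rewrite mulr_gt0.
- apply: measurable_funM; first exact: measurable_flow_moment.
  by apply: continuous_measurable_fun; exact: continuous_ln_flow_density.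
- by move=> x; exact: hK.
Qed.

Lemma integrable_entropy_density_der s : 0 < s ->
  leb.-integrable setT (EFin \o
    (fun x => flow_density_dot s x * (ln (flow_moment 0 s x) + 1))).
Proof.
move=> s0; have [K K0 hK] := entropy_density_der_dom s0 (lexx s).
apply: (@integrable_weighted _ K (2 * s)); first by rewrite mulr_gt0.
- apply: measurable_funM.
    by apply: continuous_measurable_fun; exact: continuous_flow_density_dot.
  apply: measurable_funD => //.
  by apply: continuous_measurable_fun; exact: continuous_ln_flow_density.
- by move=> x; exact: hK.
Qed.

Lemma integrable_score_density s : 0 < s ->
  leb.-integrable setT (EFin \o score_density s).
Proof.
move=> s0; have [K K0 hK] := score_density_dom s0 (lexx s).
apply: (@integrable_weighted _ K (2 * s)); first by rewrite mulr_gt0.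
- by apply: continuous_measurable_fun; exact: continuous_score_density.
- by move=> x; exact: hK.
Qed.

Lemma derivable_flow_fisher s : 0 < s -> derivable flow_fisher s 1.
Proof.
move=> s0; have s20 : 0 < s / 2 by rewrite divr_gt0.
have ss : s / 2 <= 2 * s by lra.
have [K K0 hK] := score_density_dot_dom s20 ss.
suff : is_derive s 1 flow_fisher (\int[leb]_x score_density_dot s x) by case.
apply: (@is_derive_under_integral _ _ _ leb score_density score_density_dot
  (fun x => K * ((1 + x ^+ 2) * flow_moment 0 (2 * (2 * s)) x)) s (s / 2)
    (2 * s)).
- by lra.
- by lra.
- by move=> z z1 _; apply: integrable_score_density; exact: lt_trans z1.
- by move=> z x z1 _; apply: is_derive_score_density; exact: lt_trans z1.
- by apply/integrable_cstZ/(integrable_flow_density mu2); rewrite !mulr_gt0.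
- by move=> z x z1 z2; apply: hK; exact: ltW.
Qed.

(** The integrand [2 d_s f (1 + ln f) + (d_x f)^2 / f] is the space derivative of
[d_x f (1 + ln f)], which vanishes at infinity. *)
Lemma integration_by_parts_score s : 0 < s ->
  \int[leb]_x (flow_density_dot s x * (ln (flow_moment 0 s x) + 1))
    = - (flow_fisher s / 2).
Proof.
move=> s0.
pose U x := - (flow_moment 1 s x / s) * (ln (flow_moment 0 s x) + 1).
pose D x := 2 * (flow_density_dot s x * (ln (flow_moment 0 s x) + 1))
  + score_density s x.
have iD1 := integrable_entropy_density_der s0.
have iD2 := integrable_score_density s0.
have s2 : 0 < 2 * s by rewrite mulr_gt0.
suff : \int[leb]_x D x = 0.
  rewrite /D RintegralD//; last exact: integrable_cstZ.
  by rewrite RintegralZl// -/(flow_fisher s); lra.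
have [C C0 hC] := flow_moment_dom mu 1 s0 (lexx s).
have [L L0 hL] := ln_flow_density_bound mu2 s0 (lexx s).
have Ub x : `|U x| <= C * (L + 1) / s *
  ((1 + x ^+ 2) * flow_moment 0 (2 * s) x).
  have -> : C * (L + 1) / s * ((1 + x ^+ 2) * flow_moment 0 (2 * s) x) =
    C * flow_moment 0 (2 * s) x / s * ((L + 1) * (1 + x ^+ 2)) by ring.
  rewrite /U normrM normrN normrM; apply: ler_pM => //.
    rewrite [`|s^-1|]ger0_norm ?invr_ge0 ?(ltW s0)//; apply: ler_wpM2r.
      by rewrite invr_ge0 ltW.
    exact: hC.
  rewrite (le_trans (ler_normD _ _))// mulrDl mul1r normr1; apply: lerD;
    first exact: hL.
  exact: weight_ge1.
have Ulim (u : nat -> R) : (forall n, `|u n| = n%:R) ->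
  U (u n) @[n --> \oo] --> 0.
  move=> uE; apply/norm_cvg0P.
  apply: (@squeeze_cvgr _ _ _ _ (cst 0)
    (fun n => C * (L + 1) / s *
      ((1 + u n ^+ 2) * flow_moment 0 (2 * s) (u n)))).
  - by apply: nearW => n; rewrite normr_ge0 /= Ub.
  - exact: cvg_cst.
  - rewrite -[X in _ --> X](mulr0 (C * (L + 1) / s)); apply: cvgM;
      first exact: cvg_cst.
    exact: (flow_density_decay mu2).
apply: (@Rintegral_derivative_eq0 _ U D).
- move=> x; have f0 := flow_density_gt0 mu2 x s0.
  have d0 := is_derive_flow_moment_x mu 0 x s0.
  have d1 := is_derive_flow_moment_x mu 1 x s0.
  have dl := is_derive_comp_fun (g := flow_moment 0 s) (is_derive1_ln f0) d0.
  apply: (is_derive_eq (is_deriveM_fun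
    (is_deriveN_fun (is_deriveM_fun d1 (is_derive_cst_fun s^-1 x)))
    (is_deriveD_fun dl (is_derive_cst_fun 1 x)))).
  rewrite /D /flow_density_dot /score_density /=.
  by field; rewrite gt_eqF//= gt_eqF.
- move=> x; apply: cvgD; last exact: continuous_score_density.
  apply: cvgM; first exact: cvg_cst.
  apply: cvgM; first exact: continuous_flow_density_dot.
  by apply: cvgD; [exact: continuous_ln_flow_density|exact: cvg_cst].
- by apply: integrable_add => //; exact: integrable_cstZ.
- by apply: Ulim => n; rewrite ger0_norm.
- by apply: Ulim => n; rewrite normrN ger0_norm.
Qed.

(** [d_s (f ln f) = d_s f (1 + ln f)]; integration by parts does the rest. *)
Lemma de_bruijn s : 0 < s -> is_derive s 1 flow_entropy (flow_fisher s / 2).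
Proof.
move=> s0; have s20 : 0 < s / 2 by rewrite divr_gt0.
have ss : s / 2 <= 2 * s by lra.
have [K K0 hK] := entropy_density_der_dom s20 ss.
rewrite -[flow_fisher s / 2]opprK -(integration_by_parts_score s0).
apply: is_deriveN_fun.
apply: (@is_derive_under_integral _ _ _ leb
  (fun s x => flow_moment 0 s x * ln (flow_moment 0 s x))
  (fun s x => flow_density_dot s x * (ln (flow_moment 0 s x) + 1))
  (fun x => K * ((1 + x ^+ 2) * flow_moment 0 (2 * (2 * s)) x)) s (s / 2)
    (2 * s)).
- by lra.
- by lra.
- by move=> z z1 _; apply: integrable_entropy_density; exact: lt_trans z1.
- move=> z x z1 _; have z0 : 0 < z by exact: lt_trans z1.
  have f0 := flow_density_gt0 mu2 x z0.
  have d0 := is_derive_flow_moment_s mu 0 x z0.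
  have dl := is_derive_comp_fun (g := flow_moment 0 ^~ x) (is_derive1_ln f0) d0.
  apply: (is_derive_eq (is_deriveM_fun d0 dl));
    rewrite -/(flow_density_dot z x).
  by field; rewrite gt_eqF.
- by apply/integrable_cstZ/(integrable_flow_density mu2); rewrite !mulr_gt0.
- by move=> z x z1 z2; apply: hK; exact: ltW.
Qed.

End entropy_fisher.

(** * Integration against a density *)

Section integral_against_density.
Context {d : measure_display} {T : measurableType d} {R : realType}.
Variables (nu : {finite_measure set T -> \bar R})
  (la : {sigma_finite_measure set T -> \bar R}).
Variable f : T -> R.
Hypothesis mf : measurable_fun setT f.
Hypothesis f0 : forall x, 0 <= f x.
Hypothesis nuf : forall A, measurable A ->
  nu A = (\int[la]_(x in A) (f x)%:E)%E.

(** [f] agrees almost everywhere with the Radon-Nikodym derivative. *)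
Lemma ge0_integral_density (h : T -> \bar R) :
  measurable_fun setT h -> (forall x, 0 <= h x)%E ->
  (\int[nu]_x h x = \int[la]_x (h x * (f x)%:E))%E.
Proof.
move=> mh h0.
have mfE : measurable_fun setT (EFin \o f) by exact/measurable_EFinP.
have dom : nu `<< la.
  apply/null_content_dominatesP => A mA A0; rewrite nuf//.
  by apply: null_set_integral => //; exact: measurable_funTS.
rewrite -(Radon_Nikodym_SigmaFinite.change_of_variables dom)//.
have irn := Radon_Nikodym_SigmaFinite.f_integrable dom.
apply: ae_eq_integral => //.
- by apply: emeasurable_funM => //; exact: measurable_int irn.
- exact: emeasurable_funM.
have := integral_ae_eq measurableT irn mfE _.
have h1 : forall E, E `<=` setT -> measurable E ->
   (\int[la]_(x in E) Radon_Nikodym_SigmaFinite.f nu la x = \int[la]_(x in E)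
     (EFin \o f) x)%E.
  by move=> E _ mE; rewrite -Radon_Nikodym_SigmaFinite.f_integral// nuf.
by move=> /(_ h1); apply: filterS => x /= hx xT; rewrite hx.
Qed.

Lemma integral_density (h : T -> \bar R) : measurable_fun setT h ->
  (\int[nu]_x h x = \int[la]_x (h x * (f x)%:E))%E.
Proof.
move=> mh; rewrite integralE [RHS]integralE.
rewrite !ge0_integral_density//; last 2 first.
- exact: measurable_funeneg.
- exact: measurable_funepos.
congr (_ - _)%E; apply: eq_integral => x _.
  by rewrite muleC !funeposE maxe_pMr ?mule0 ?lee_fin// muleC.
by rewrite muleC !funenegE maxe_pMr ?mule0 ?lee_fin// muleN muleC.
Qed.

End integral_against_density.

Section lebesgue_shift.
Context {R : realType}.
Local Notation leb := (@lebesgue_measure R).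

(** Translation invariance of the Lebesgue measure, checked on intervals. *)
Lemma ge0_integral_shift (psi : R -> \bar R) (y : R) :
  measurable_fun setT psi -> (forall x, 0 <= psi x)%E ->
  (\int[leb]_z psi (y + z)%R = \int[leb]_x psi x)%E.
Proof.
move=> mpsi psi0.
have mphi : measurable_fun setT
  (fun z : measurableTypeR R => (y + z)%R : measurableTypeR R).
  exact: measurable_funD.
rewrite -[LHS](@ge0_integral_pushforward _ _ _ _ _
  (fun z : measurableTypeR R => (y + z)%R : measurableTypeR R) mphi leb setT)//.
apply: eq_measure_integral => A mA _; apply/esym/lebesgue_measure_unique => //.
move=> _ [[a b]] _ <-.
change (leb `]a, b]%classic = leb ((fun z : R => (y + z)%R) @^-1` `]a,
  b]%classic)).
have -> : (fun z : R => (y + z)%R) @^-1` `]a, b]%classic = `]a - y, b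
  - y]%classic.
  by apply/seteqP; split => z /=; rewrite !in_itv/= ltrBlDl lerBrDl.
rewrite !lebesgue_measure_itv/= !lte_fin ltrD2r.
by case: ifP => // _; rewrite -!EFinB; congr EFin; ring.
Qed.

End lebesgue_shift.

Section continuous_density.
Context {R : realType}.
Local Notation leb := (@lebesgue_measure R).

(** A continuous density is the derivative of the distribution function. *)
Lemma continuous_density_unique (nu : {finite_measure set R -> \bar R})
  (f g : R -> R) :
  (forall x, 0 <= f x) -> (forall x, 0 <= g x) -> continuous f ->
    continuous g ->
  (forall A, measurable A -> nu A = (\int[leb]_(x in A) (f x)%:E)%E) ->
  (forall A, measurable A -> nu A = (\int[leb]_(x in A) (g x)%:E)%E) ->
  f = g.
Proof.
move=> f0 g0 cf cg nf ng; apply/funext => x.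
have main (h : R -> R) : (forall x, 0 <= h x) -> continuous h ->
    (forall A, measurable A -> nu A = (\int[leb]_(x in A) (h x)%:E)%E) ->
    h x = (fun u => fine (nu `]-oo, u]%classic))^`()%classic x.
  move=> h0 ch nh.
  have ih : leb.-integrable `]-oo, (x + 1)] (EFin \o h).
    apply/integrableP; split.
      by apply/measurable_EFinP; apply: measurable_funTS;
        exact: continuous_measurable_fun.
    under eq_integral do rewrite /= ger0_norm//.
    rewrite -nh; last exact: measurable_itv.
    rewrite -ge0_fin_numE// fin_num_measure//; exact: measurable_itv.
  have x1 : x < x + 1 by rewrite ltrDl.
  have [||_ <-] := @continuous_FTC1 R h -oo%O x (x + 1) x1 ih.
  - by rewrite ltNyr.
  - exact: ch.
  congr (_^`()%classic x); apply/funext => u.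
  by rewrite /Rintegral -nh//; exact: measurable_itv.
by rewrite (main f)// -(main g).
Qed.

End continuous_density.

(** * Gaussian moments *)

Section gaussian_moments.
Context {R : realType}.
Local Notation leb := (@lebesgue_measure R).
Implicit Types (s x y z m : R) (k : nat).

Lemma integrable_kernel_moment_lebesgue k s m : 0 < s ->
  leb.-integrable setT (EFin \o (fun x => kernel_moment k s (x - m))).
Proof.
move=> s0; have [C C0 hC] := kernel_moment_dom k s0 (lexx s).
have s20 : 0 < 2 * s by rewrite mulr_gt0.
have mk j t : 0 < t -> measurable_fun setT (fun x => kernel_moment j t (x - m)).
  by move=> t0; apply: (measurableT_comp (measurable_kernel_moment j t0));
    exact: measurable_funB.
apply: (@integrable_dominated _ _ _ leb _
  (fun x => C * heat_kernel (2 * s) (x - m))).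
- exact: mk.
- apply: integrable_cstZ; apply/integrableP; split.
    apply/measurable_EFinP; have := mk 0%N _ s20.
    by apply: eq_measurable_fun => x _; rewrite kernel_moment0.
  under eq_integral do rewrite /= gtr0_norm ?heat_kernel_gt0//.
  by rewrite integral_heat_kernel_shift// ltry.
- by move=> x; exact: hC.
Qed.

Lemma kernel_moment_cvg0 k s m (u : nat -> R) : 0 < s ->
  (forall n, `|u n| = n%:R) ->
  kernel_moment k s (u n - m) @[n --> \oo] --> 0.
Proof.
move=> s0 uE; have [C C0 hC] := kernel_moment_bounded k.+1 s0 (lexx s).
apply/norm_cvg0P.
apply: (@squeeze_cvgr _ _ _ _ (cst 0) (fun n => 2 * C * n.+1%:R^-1)).
- near=> n; rewrite normr_ge0/= ler_pdivlMr//.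
  have hz : n.+1%:R <= 2 * `|u n - m|.
    have := lerB_dist (u n) m; rewrite uE -natr1.
    have : 2 * `|m| + 1 <= n%:R by near: n; exact: nbhs_infty_ger.
    by lra.
  apply: (@le_trans _ _ (2 * (`|u n - m| * `|kernel_moment k s (u n - m)|))).
    by rewrite mulrA mulrC ler_wpM2r.
  rewrite ler_pM2l// -normrM.
  have -> : (u n - m) * kernel_moment k s (u n - m) = kernel_moment k.+1 s
    (u n - m) by rewrite /kernel_moment exprS mulrA.
  exact: hC.
- exact: cvg_cst.
- rewrite -[X in _ --> X](mulr0 (2 * C)); apply: cvgM; first exact: cvg_cst.
  exact: cvg_harmonic.
Unshelve. all: end_near. Qed.

Lemma Rintegral_heat_kernel s m : 0 < s ->
  \int[leb]_x heat_kernel s (x - m) = 1.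
Proof. by move=> s0; rewrite /Rintegral integral_heat_kernel_shift. Qed.

(** Integrate [d_x ((x - m)^k K)] over the line: one recursion yields the mean and
the variance. *)
Lemma Rintegral_kernel_moment_recursion k s m : 0 < s ->
  \int[leb]_x kernel_moment k.+1 s (x - m) = s *
    (k%:R * \int[leb]_x kernel_moment k.-1 s (x - m)).
Proof.
move=> s0.
have i1 := integrable_kernel_moment_lebesgue k.-1 m s0.
have i2 := integrable_kernel_moment_lebesgue k.+1 m s0.
pose D x := k%:R * kernel_moment k.-1 s (x - m) - s^-1 * kernel_moment k.+1 s
  (x - m).
suff : \int[leb]_x D x = 0.
  rewrite /D RintegralB//; [|exact: integrable_cstZ..].
  rewrite !RintegralZl// => /eqP; rewrite subr_eq0 => /eqP ->.
  by rewrite mulrA divff ?mul1r// gt_eqF.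
apply: (@Rintegral_derivative_eq0 _ (fun x => kernel_moment k s (x - m)) D).
- move=> x; have hs : is_derive x 1 (fun x => x - m) 1.
    by apply: (is_derive_eq (is_deriveB_fun (is_derive_id_fun x)
      (is_derive_cst_fun m x))); rewrite subr0.
  apply: (is_derive_eq (is_derive_comp_fun (g := fun x => x - m)
    (is_derive_kernel_moment_z k (x - m) s0) hs)).
  by rewrite /D mulr1 [_ / s]mulrC.
- have ck j : continuous (fun x => kernel_moment j s (x - m)).
    move=> x; apply: (@continuous_comp _ _ _ (fun x => x - m)
      (kernel_moment j s)); last exact: continuous_kernel_moment.
    by apply: cvgB; [exact: cvg_id|exact: cvg_cst].
  by move=> x; apply: cvgB; apply: cvgM; by [exact: cvg_cst|exact: ck].
- by apply: integrable_sub; exact: integrable_cstZ.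
- by apply: kernel_moment_cvg0 => // n; rewrite ger0_norm.
- by apply: kernel_moment_cvg0 => // n; rewrite normrN ger0_norm.
Qed.

Lemma gaussian_mean s m : 0 < s -> \int[leb]_x (x * heat_kernel s (x - m)) = m.
Proof.
move=> s0; have h := Rintegral_kernel_moment_recursion 0 m s0.
have i1 := integrable_kernel_moment_lebesgue 1 m s0.
have i0 := integrable_kernel_moment_lebesgue 0 m s0.
rewrite (_ : \int[leb]_x _ = \int[leb]_x
  (kernel_moment 1 s (x - m) + m * kernel_moment 0 s (x - m))); last first.
  by apply: eq_Rintegral => x _; rewrite /kernel_moment; ring.
rewrite RintegralD//; last exact: integrable_cstZ.
rewrite RintegralZl// h mul0r mulr0 add0r.
under eq_Rintegral do rewrite kernel_moment0.
by rewrite Rintegral_heat_kernel// mulr1.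
Qed.

Lemma gaussian_second_moment s m : 0 < s ->
  \int[leb]_x (x ^+ 2 * heat_kernel s (x - m)) = s + m ^+ 2.
Proof.
move=> s0.
have h1 := Rintegral_kernel_moment_recursion 0 m s0.
have h2 := Rintegral_kernel_moment_recursion 1 m s0.
have i2 := integrable_kernel_moment_lebesgue 2 m s0.
have i1 := integrable_kernel_moment_lebesgue 1 m s0.
have i0 := integrable_kernel_moment_lebesgue 0 m s0.
have h0 : \int[leb]_x kernel_moment 0 s (x - m) = 1.
  by under eq_Rintegral do rewrite kernel_moment0;
    rewrite Rintegral_heat_kernel.
rewrite (_ : \int[leb]_x _ = \int[leb]_x (kernel_moment 2 s (x - m) +
  (2 * m * kernel_moment 1 s (x - m) + m ^+ 2 * kernel_moment 0 s (x - m))));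
    last first.
  by apply: eq_Rintegral => x _; rewrite /kernel_moment; ring.
rewrite RintegralD//; last by apply: integrable_add; exact: integrable_cstZ.
rewrite RintegralD//; [|exact: integrable_cstZ..].
have e1 := RintegralZl (2 * m) measurableT i1;
  have e0 := RintegralZl (m ^+ 2) measurableT i0.
by rewrite e1 e0 h2 h1 /= h0; ring.
Qed.

End gaussian_moments.

(** * Densities of random variables *)

Section marginal_laws.
Context {d : measure_display} {T : measurableType d} {R : realType}.
Variable P : probability T R.
Local Notation leb := (@lebesgue_measure R).
Implicit Types (X Y W : {RV P >-> R}) (s x y : R).

Lemma measurable_heat_kernel_shift s m : 0 < s ->
  measurable_fun setT (fun x : R => heat_kernel s (x - m)).
Proof.
move=> s0; have mh : measurable_fun setT (heat_kernel s).
  have := measurable_kernel_moment 0 s0; apply: eq_measurable_fun => z _;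
    exact: kernel_moment0.
by apply: (measurableT_comp mh); exact: measurable_funB.
Qed.

Lemma integral_distributionE d' (T' : measurableType d') (X : {mfun T >-> T'})
    (h : T' -> \bar R) : measurable_fun setT h ->
  (\int[distribution P X]_x h x = \int[P]_w h (X w))%E.
Proof.
move=> mh; rewrite integralE [RHS]integralE.
rewrite !ge0_integral_distribution//; last 2 first.
- exact: measurable_funeneg.
- exact: measurable_funepos.
by congr (_ - _)%E; apply: eq_integral => w _; rewrite /= ?funeposE ?funenegE.
Qed.

Lemma integral_is_density X (f : R -> R) (h : R -> \bar R) : is_density X f ->
  measurable_fun setT h -> (\int[P]_w h (X w) = \int[leb]_x (h x * (f x)%:E))%E.
Proof.
move=> [mf f0 hf] mh.
(* The Lebesgue measure lives on [measurableTypeR R], so [X] is read as a random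
   variable with values in that type. *)
have mX : measurable_fun setT (X : T -> measurableTypeR R)
  by move=> mT A mA; exact: (measurable_funP X).
pose X' : {mfun T >-> measurableTypeR R} := HB.pack (X : T -> measurableTypeR R)
  (isMeasurableFun.Build _ _ _ _ _ mX).
rewrite -(@integral_density _ (measurableTypeR R) _ (distribution P X')
  (@lebesgue_measure R) f mf f0 hf h mh).
exact/esym/(@integral_distributionE _ _ X' h mh).
Qed.

Lemma gaussian_law_density X m v : 0 < v -> gaussian_law P m v X ->
  is_density X (fun x => heat_kernel v (x - m)).
Proof.
move=> v0 hX; split; [exact: measurable_heat_kernel_shift|by move=> x;
  rewrite ltW// heat_kernel_gt0|].
move=> A mA; have := hX A mA; rewrite gt_eqF// /normal_prob => hA.
rewrite [LHS]hA; apply: eq_integral => x _.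
by rewrite normal_pdf_heat_kernel.
Qed.

Lemma integral_gaussian_law0 X m (h : R -> \bar R) : gaussian_law P m 0 X ->
  measurable_fun setT h -> (\int[P]_w h (X w) = h m)%E.
Proof.
move=> hX mh.
rewrite -integral_distributionE//.
rewrite (eq_measure_integral (dirac m)); last first.
  by move=> A mA _; have := hX A mA; rewrite eqxx.
by rewrite integral_dirac// diracT mul1e.
Qed.

(** The law of [B t] is Gaussian, so its first two moments determine it; the second
one is positive, which excludes a point mass. *)
Lemma fbm_marginal_density (H t : R) (B : R -> {RV P >-> R}) : 0 < H -> 0 < t ->
  fractional_brownian_motion H B ->
    is_density (B t) (heat_kernel (t `^ (2 * H))).
Proof.
move=> H0 t0 [gB cB _ covB].
have [m [v [v0]]] := gB 1%N (fun=> t) (fun=> 1) (fun=> ltW t0).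
have -> : (fun w => \sum_(i < 1) 1 * B t w) = B t.
  by apply/funext => w; rewrite big_ord1 mul1r.
move=> gBt.
have mid : measurable_fun setT (EFin : R -> \bar R) by apply/measurable_EFinP;
  exact: measurable_id.
have msq : measurable_fun setT (fun x : R => (x ^+ 2)%:E).
  by apply/measurable_EFinP; exact: measurable_funX.
have h1 : (\int[P]_w (B t w)%:E = 0)%E by rewrite -(cB t (ltW t0)) unlock.
have t2H : 0 < t `^ (2 * H) by rewrite powR_gt0.
have h2 : (\int[P]_w ((B t w) ^+ 2)%:E = (t `^ (2 * H))%:E)%E.
  have := covB t t (ltW t0) (ltW t0);
    rewrite unlock subrr normr0 powR0 ?mulf_neq0 ?gt_eqF// subr0.
  have -> : 2^-1 * (t `^ (2 * H) + t `^ (2 * H)) = t `^ (2 * H) by field.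
  by move=> <-; apply: eq_integral => w _; rewrite expr2.
move: v0; rewrite le_eqVlt => /predU1P[v0|v0].
  rewrite -v0 in gBt.
  have := integral_gaussian_law0 gBt mid; rewrite h1 => -[m0].
  have := integral_gaussian_law0 gBt msq; rewrite h2 -m0 expr0n => -[t2].
  by rewrite t2 ltxx in t2H.
have dB := gaussian_law_density v0 gBt.
have m0 : m = 0.
  rewrite -(gaussian_mean m v0) /Rintegral.
  have := integral_is_density dB mid; rewrite h1 => h.
  by rewrite -[RHS]/(fine 0%E) h.
have vt : v = t `^ (2 * H).
  have := gaussian_second_moment m v0; rewrite m0 expr0n addr0 /Rintegral => <-.
  have := integral_is_density dB msq; rewrite h2 => h.
  by rewrite -[RHS]/(fine (t `^ (2 * H))%:E) h m0.
rewrite -vt; have -> : heat_kernel v = (fun x => heat_kernel v (x - m))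
  by apply/funext => x; rewrite m0 subr0.
by [].
Qed.

End marginal_laws.

Section convolution.
Context {d : measure_display} {T : measurableType d} {R : realType}.
Variable P : probability T R.
Local Notation leb := (@lebesgue_measure R).
Implicit Types (X Y W : {RV P >-> R}) (s x y : R).

(** Independence makes the joint law a product, and Tonelli's theorem moves the
integral over the law of [X] inside, onto the kernel. *)
Lemma ge0_integral_convolution X Y s (psi : R -> \bar R) : 0 < s ->
  (forall A C, measurable A -> measurable C ->
    P (X @^-1` A `&` Y @^-1` C) = (P (X @^-1` A) * P (Y @^-1` C))%E) ->
  is_density Y (heat_kernel s) -> measurable_fun setT psi ->
    (forall x, 0 <= psi x)%E ->
  (\int[P]_w psi (X w + Y w)%R =
   \int[leb]_x (psi x * (flow_moment (distribution P X) 0 s x)%:E))%E.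
Proof.
move=> s0 ind dY mpsi psi0.
pose Z w := (X w, Y w).
have mZ : measurable_fun setT Z by exact: measurable_fun_pair.
pose psi2 (z : R * R) := psi (z.1 + z.2).
have mpsi2 : measurable_fun setT psi2 by apply: (measurableT_comp mpsi);
  exact: measurable_funD.
have psi20 z : (0 <= psi2 z)%E by exact: psi0.
have -> : (\int[P]_w psi (X w + Y w)%R = \int[pushforward P Z]_z psi2 z)%E.
  by rewrite ge0_integral_pushforward.
have -> : (\int[pushforward P Z]_z psi2 z =
    \int[(distribution P X) \x (distribution P Y)]_z psi2 z)%E.
  apply: eq_measure_integral => A mA _; apply/esym.
  by apply: product_measure_unique => //.
rewrite fubini_tonelli1//.
have step1 y : (fubini_F (distribution P Y) psi2 y =
    \int[leb]_x (psi x * (heat_kernel s (x - y))%:E))%E.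
  rewrite /fubini_F.
  have mpsiy : measurable_fun setT (fun z => psi (y + z)).
    by apply: (measurableT_comp mpsi); exact: measurable_funD.
  rewrite ge0_integral_distribution//.
  rewrite [LHS](integral_is_density dY mpsiy).
  rewrite -(@ge0_integral_shift R
    (fun x => psi x * (heat_kernel s (x - y))%:E)%E y).
  - by apply: eq_integral => z _; rewrite [y + z]addrC addrK.
  - by apply: emeasurable_funM => //; apply/measurable_EFinP;
      exact: measurable_heat_kernel_shift.
  - by move=> x; rewrite mule_ge0// lee_fin ltW// heat_kernel_gt0.
under eq_integral do rewrite step1.
pose h (z : R * measurableTypeR R) : \bar R :=
  (psi z.2 * (heat_kernel s (z.2 - z.1))%:E)%E.
have h0 (z : R * measurableTypeR R) : (0 <= h z)%E.
  by rewrite mule_ge0// lee_fin ltW// heat_kernel_gt0.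
have mh : measurable_fun setT h.
  apply: emeasurable_funM.
    by apply: (measurableT_comp mpsi).
  apply/measurable_EFinP.
  have mh1 : measurable_fun setT (heat_kernel s).
    by have := measurable_heat_kernel_shift 0 s0;
      apply: eq_measurable_fun => z _; rewrite subr0.
  by apply: (measurableT_comp mh1); exact: measurable_funB.
rewrite (@fubini_tonelli _ _ _ _ _ (distribution P X) (@lebesgue_measure R)
  h)//.
apply: eq_integral => x _.
rewrite /h/= ge0_integralZl//.
- by rewrite flow_density_EFin.
- apply/measurable_EFinP.
  have := measurable_kernel_moment_shift 0 x s0;
    apply: eq_measurable_fun => y _; exact: kernel_moment0.
- by move=> y _; rewrite lee_fin ltW// heat_kernel_gt0.
Qed.

End convolution.

Section entropy_of_sum.
Context {d : measure_display} {T : measurableType d} {R : realType}.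
Variable P : probability T R.
Local Notation leb := (@lebesgue_measure R).
Implicit Types (X Y W : {RV P >-> R}) (s x y : R).

Lemma is_density_sum X Y W s : 0 < s ->
  (forall A C, measurable A -> measurable C ->
    P (X @^-1` A `&` Y @^-1` C) = (P (X @^-1` A) * P (Y @^-1` C))%E) ->
  is_density Y (heat_kernel s) -> (forall w, W w = X w + Y w) ->
  is_density W (flow_moment (distribution P X) 0 s).
Proof.
move=> s0 ind dY WE; split.
- exact: measurable_flow_moment.
- move=> x; rewrite flow_densityE; apply: Rintegral_ge0 => y _.
  by rewrite ltW// heat_kernel_gt0.
- move=> A mA.
  have mi : measurable_fun setT (fun x : R => (\1_A x)%:E : \bar R).
    by apply/measurable_EFinP; exact: measurable_indic.
  have i0 (x : R) : (0 <= (\1_A x)%:E :> \bar R)%E by rewrite lee_fin.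
  have h := ge0_integral_convolution s0 ind dY mi i0.
  rewrite [RHS]integral_mkcond.
  have -> : (\int[leb]_x ((fun x => (flow_moment (distribution P X) 0 s x)%:E)
    \_ A) x =
     \int[leb]_x ((\1_A x)%:E * (flow_moment (distribution P X) 0 s x)%:E))%E.
    apply: eq_integral => x _; rewrite patchE indicE.
    by case: (x \in A); rewrite ?mul1e ?mul0e.
  rewrite -h.
  have mWA : measurable (W @^-1` A).
    by rewrite -[X in measurable X]setTI; exact: measurable_funP.
  have -> : distribution P W A = (\int[P]_w (\1_(W @^-1` A) w)%:E)%E.
    by rewrite integral_indic// setIT.
  by apply: eq_integral => w _; rewrite !indicE -WE.
Qed.

Lemma integrable_sqr_distribution X : ('E_P[(fun w => X w ^+ 2)%R] < +oo)%E ->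
  (distribution P X).-integrable setT (fun y => (y ^+ 2)%:E).
Proof.
rewrite unlock => hX; have msq : measurable_fun setT (fun y : R => (y ^+ 2)%:E).
  by apply/measurable_EFinP; exact: measurable_funX.
apply/integrableP; split => //.
under eq_integral do rewrite gee0_abs ?lee_fin ?sqr_ge0//.
by rewrite ge0_integral_distribution// => y; rewrite lee_fin sqr_ge0.
Qed.

Lemma density_continuous X f : is_density X f -> continuous f -> density X = f.
Proof.
move=> dX cf.
have [dD cD] : is_density X (density X) /\
    ((exists2 g : R -> R, is_density X g & continuous g) ->
      continuous (density X)).
  by apply: (@getPex _ [set h : R -> R | is_density X h /\
    ((exists2 g : R -> R, is_density X g & continuous g) -> continuous h)]);
      exists f.
have cDX : continuous (density X) by apply: cD; exists f.
case: dD dX => [_ D0 hD] [_ f0 hf].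
exact: (continuous_density_unique D0 f0 cDX cf hD hf).
Qed.

Section sum.
Variables (X Y W : {RV P >-> R}) (s : R).
Hypothesis s0 : 0 < s.
Hypothesis ind : forall A C, measurable A -> measurable C ->
    P (X @^-1` A `&` Y @^-1` C) = (P (X @^-1` A) * P (Y @^-1` C))%E.
Hypothesis dY : is_density Y (heat_kernel s).
Hypothesis WE : forall w, W w = X w + Y w.
Hypothesis X2 : ('E_P[(fun w => X w ^+ 2)%R] < +oo)%E.
Let mu := distribution P X.

Lemma density_sum : density W = flow_moment mu 0 s.
Proof.
apply: density_continuous; first exact: is_density_sum ind dY WE.
exact: continuous_flow_moment.
Qed.

Lemma entropy_sum : entropy W = (flow_entropy mu s)%:E.
Proof.
have mu2 := integrable_sqr_distribution X2.
rewrite /entropy density_sum unlock /flow_entropy EFinN; congr (- _)%E.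
rewrite fineK; last exact: integrable_fin_num
  (integrable_entropy_density mu2 s0).
rewrite (@integral_is_density _ _ _ P W _
  (fun x => (ln (flow_moment mu 0 s x))%:E)
  (is_density_sum s0 ind dY WE)).
  by apply: eq_integral => x _; rewrite /= -EFinM mulrC.
apply/measurable_EFinP; apply: continuous_measurable_fun.
exact: continuous_ln_flow_density.
Qed.

Lemma fisher_sum : fisher_information W = (flow_fisher mu s)%:E.
Proof.
have mu2 := integrable_sqr_distribution X2.
rewrite /fisher_information density_sum unlock /flow_fisher.
have dln x : (fun x => ln (flow_moment mu 0 s x))^`()%classic x
  = - (flow_moment mu 1 s x / s) / flow_moment mu 0 s x.
  have f0 := flow_density_gt0 mu2 x s0.
  have d0 := is_derive_flow_moment_x mu 0 x s0.
  have := is_derive_comp_fun (g := flow_moment mu 0 s) (is_derive1_ln f0) d0.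
  by rewrite derive1E => -[_ ->] /=; ring.
rewrite fineK; last exact: integrable_fin_num (integrable_score_density mu2 s0).
have dlnE : (fun x => ln (flow_moment mu 0 s x))^`()%classic =
  (fun x => - (flow_moment mu 1 s x / s) / flow_moment mu 0 s x)
    by apply/funext.
rewrite dlnE.
rewrite (@integral_is_density _ _ _ P W _
  (fun x => ((- (flow_moment mu 1 s x / s) / flow_moment mu 0 s x) ^+ 2)%:E)
  (is_density_sum s0 ind dY WE)).
  apply: eq_integral => x _; rewrite /= -EFinM /score_density; congr EFin.
  by field; rewrite !gt_eqF//= (flow_density_gt0 mu2).
apply/measurable_EFinP; apply: measurable_funX;
  apply: continuous_measurable_fun => x.
apply: cvgM.
  by apply: cvgN; apply: cvgM; [exact: continuous_flow_moment|exact: cvg_cst].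
apply: cvgV; first by rewrite gt_eqF// flow_density_gt0.
exact: continuous_flow_moment.
Qed.

End sum.

End entropy_of_sum.

(** * Convexity from the second derivative *)

Section convexity.
Context {R : realType}.

(** The derivatives are explicit functions so that the lemma applies to [- f] and
[- f1] directly: the derivative operator need not commute with the opposite
outside [I], where [f] may fail to be derivable. *)
Lemma second_derivative_convex_on (I : set R) (f f1 f2 : R -> R) :
  open I -> is_interval I ->
  (forall t : R, I t -> is_derive t 1 f (f1 t)) ->
  (forall t : R, I t -> is_derive t 1 f1 (f2 t)) ->
  (forall t, I t -> 0 <= f2 t) ->
  convex_on I f.
Proof.
move=> oI itI df ddf d2f t x y; rewrite !inE => Ix Iy.
have dfE z : I z -> 'D_1 f z = f1 z by move=> Iz; have [_ ->] := df z Iz.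
have ddfE z : I z -> is_derive z 1 ('D_1 f) (f2 z).
  move=> Iz; apply: near_eq_is_derive (ddf z Iz).
  by near=> u; rewrite dfE//; near: u; exact: open_nbhs_nbhs.
have main a b (u : {i01 R}) : I a -> I b -> a <= b ->
    f (conv u (a : R^o) (b : R^o)) <= conv u (f a : R^o) (f b : R^o).
  move=> Ia Ib ab.
  have Iz z : a <= z <= b -> I z by apply: itI.
  have cf z : I z -> f @ z --> f z by move=> Iz';
    exact: (is_derive_continuous (df z Iz')).
  apply: second_derivative_convex => //.
  - move=> z /andP[az zb]; have Iz' : I z by apply: Iz; rewrite !ltW.
    by have [_ ->] := ddfE z Iz'; exact: d2f.
  - exact/cvg_at_left_filter/cf.
  - exact/cvg_at_right_filter/cf.
  - move=> z; rewrite in_itv/= => /andP[az zb].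
    by have [] := df z (Iz z _) => //; rewrite !ltW.
  - move=> z; rewrite in_itv/= => /andP[az zb].
    by have [] := ddfE z (Iz z _) => //; rewrite !ltW.
have [xy|/ltW yx] := leP x y; first exact: main.
by rewrite convC [leRHS]convC; exact: main.
Unshelve. all: end_near. Qed.

End convexity.

(** * Gaussian initial data *)

Section gaussian_start.
Context {d : measure_display} {T : measurableType d} {R : realType}.
Variable P : probability T R.
Implicit Types (X : {RV P >-> R}) (s v x y : R).

(** Completing the square in [y]. *)
Lemma heat_kernelM s v x y : 0 < s -> 0 < v ->
  heat_kernel s (x - y) * heat_kernel v y = heat_kernel (s + v) x * heat_kernel
    (s * v / (s + v)) (y - v * x / (s + v)).
Proof.
move=> s0 v0; have sv0 : 0 < s + v by rewrite addr_gt0.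
have p0 : 0 < 2 * pi :> R by rewrite mulr_gt0// pi_gt0.
rewrite /heat_kernel mulrACA -expRD [RHS]mulrACA -expRD -!invfM -!sqrtrM
  ?mulr_ge0 ?(ltW p0) ?(ltW s0) ?(ltW sv0) ?pi_ge0//.
congr (_^-1 * expR _).
  by congr Num.sqrt; field; rewrite gt_eqF.
by field; rewrite !gt_eqF.
Qed.

Lemma flow_density_gaussian X v s x : 0 <= v -> 0 < s -> gaussian_law P 0 v X ->
  flow_moment (distribution P X) 0 s x = heat_kernel (s + v) x.
Proof.
move=> v0 s0 gX; rewrite flow_densityE /Rintegral.
have mh : measurable_fun setT (fun y => (heat_kernel s (x - y))%:E : \bar R).
  apply/measurable_EFinP; have := measurable_kernel_moment_shift 0 x s0.
  by apply: eq_measurable_fun => y _; exact: kernel_moment0.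
rewrite ge0_integral_distribution//; last first.
  by move=> y; rewrite lee_fin ltW// heat_kernel_gt0.
move: v0; rewrite le_eqVlt => /predU1P[v0|v0].
  rewrite -v0 in gX *; rewrite [X in fine X](integral_gaussian_law0 gX mh).
  by rewrite /= subr0 addr0.
rewrite [X in fine X](integral_is_density (gaussian_law_density v0 gX) mh).
have w0 : 0 < s * v / (s + v) by rewrite divr_gt0 ?mulr_gt0 ?addr_gt0.
under eq_integral do rewrite subr0 -EFinM heat_kernelM// EFinM.
rewrite ge0_integralZl//=.
- by rewrite integral_heat_kernel_shift// mule1.
- by apply/measurable_EFinP; exact: measurable_heat_kernel_shift.
- by move=> y _; rewrite lee_fin ltW// heat_kernel_gt0.
- by rewrite lee_fin ltW// heat_kernel_gt0// addr_gt0.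
Qed.

(** The flow is Gaussian of variance [s + v], with score [- x / (s + v)]. *)
Lemma flow_fisher_gaussian X v s : 0 <= v -> 0 < s -> gaussian_law P 0 v X ->
  flow_fisher (distribution P X) s = (s + v)^-1.
Proof.
move=> v0 s0 gX; set mu := distribution P X.
have sv0 : 0 < s + v by rewrite ltr_wpDr.
have fE : flow_moment mu 0 s = heat_kernel (s + v) by apply/funext => x;
  exact: flow_density_gaussian.
have f1E x : flow_moment mu 1 s x = s * (x / (s + v)) * heat_kernel (s + v) x.
  have := is_derive_flow_moment_x mu 0 x s0; rewrite fE => -[_].
  have [_ ->] := is_derive_heat_kernel_z x sv0.
  rewrite mul0r sub0r mulNr => /oppr_inj h.
  by rewrite -mulrA h mulrCA divff ?mulr1// gt_eqF.
rewrite /flow_fisher.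
have -> : (\int[lebesgue_measure]_x score_density mu s x =
    \int[lebesgue_measure]_x ((s + v)^-2 * kernel_moment 2 (s + v) (x - 0))).
  apply: eq_Rintegral => x _;
    rewrite /score_density f1E fE /kernel_moment subr0.
  by field; rewrite !gt_eqF// heat_kernel_gt0.
have i2 := integrable_kernel_moment_lebesgue 2 0 sv0.
have e := RintegralZl ((s + v)^-2) measurableT i2.
rewrite e Rintegral_kernel_moment_recursion//=.
have -> : \int[lebesgue_measure]_x kernel_moment 0 (s + v) (x - 0) = 1.
  by rewrite -(Rintegral_heat_kernel 0 sv0); apply: eq_Rintegral => x _;
    rewrite kernel_moment0.
by field; rewrite gt_eqF.
Qed.

End gaussian_start.

(** * The fractional Brownian flow *)

Section fbm_flow.
Context {d : measure_display} {T : measurableType d} {R : realType}.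
Variables (P : probability T R) (H : R) (X0 : {RV P >-> R}).
Variables (B : R -> {RV P >-> R}) (X : R -> {RV P >-> R}).
Hypotheses (H0 : 0 < H) (fbmB : fractional_brownian_motion H B).
Hypothesis indB : independent_rv_process X0 B.
Hypothesis X02 : ('E_P[(fun w => X0 w ^+ 2)%R] < +oo)%E.
Hypothesis XE : forall t w, 0 <= t -> X t w = X0 w + B t w.

Local Notation mu := (distribution P X0).
Local Notation clock t := (t `^ (2 * H)).

Lemma independent_marginal t A C : 0 <= t -> measurable A -> measurable C ->
  P (X0 @^-1` A `&` B t @^-1` C) = (P (X0 @^-1` A) * P (B t @^-1` C))%E.
Proof.
move=> t0 mA mC; apply: indB.
  by exists A => //; rewrite setTI.
apply: sub_sigma_algebra; exists t => //.
by exists C => //; rewrite setTI.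
Qed.

Lemma clock_gt0 t : 0 < t -> 0 < clock t.
Proof. exact: powR_gt0. Qed.

Let mu2 := integrable_sqr_distribution X02.

Lemma density_flow t : 0 < t -> density (X t) = flow_moment mu 0 (clock t).
Proof.
move=> t0; apply: (density_sum (clock_gt0 t0) _
  (fbm_marginal_density H0 t0 fbmB)).
- by move=> A C; exact: independent_marginal (ltW t0).
- by move=> w; rewrite XE// ltW.
Qed.

Lemma is_density_flow t : 0 < t ->
  is_density (X t) (flow_moment mu 0 (clock t)).
Proof.
move=> t0; apply: (is_density_sum (clock_gt0 t0) _
  (fbm_marginal_density H0 t0 fbmB)).
- by move=> A C; exact: independent_marginal (ltW t0).
- by move=> w; rewrite XE// ltW.
Qed.

Lemma entropy_flow t : 0 < t -> entropy (X t) = (flow_entropy mu (clock t))%:E.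
Proof.
move=> t0; apply: (entropy_sum (clock_gt0 t0) _
  (fbm_marginal_density H0 t0 fbmB)) => //.
- by move=> A C; exact: independent_marginal (ltW t0).
- by move=> w; rewrite XE// ltW.
Qed.

Lemma fisher_flow t : 0 < t ->
  fisher_information (X t) = (flow_fisher mu (clock t))%:E.
Proof.
move=> t0; apply: (fisher_sum (clock_gt0 t0) _
  (fbm_marginal_density H0 t0 fbmB)) => //.
- by move=> A C; exact: independent_marginal (ltW t0).
- by move=> w; rewrite XE// ltW.
Qed.

Lemma J1_flow t : 0 < t -> J1 X t = flow_fisher mu (clock t).
Proof. by move=> t0; rewrite /J1 fisher_flow. Qed.

Lemma N_flow t : 0 < t ->
  N X t = (2 * pi * expR 1)^-1 * expR (2 * flow_entropy mu (clock t)).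
Proof. by move=> t0; rewrite /N /entropy_power entropy_flow. Qed.

Lemma N_gt0 t : 0 < t -> 0 < N X t.
Proof.
move=> t0; rewrite N_flow// mulr_gt0 ?expR_gt0// invr_gt0.
by rewrite !mulr_gt0 ?expR_gt0// pi_gt0.
Qed.

Lemma near_pos (t : R) : 0 < t -> \forall u \near t, 0 < u.
Proof. by move=> t0; exact: lt_nbhsr. Qed.

Lemma is_derive_clock (t : R) : 0 < t ->
  is_derive t 1 (fun t => clock t) (2 * H * t `^ (2 * H - 1)).
Proof. by move=> t0; exact: is_derive1_powR. Qed.

Lemma derivable_J1 t : 0 < t -> derivable (J1 X) t 1.
Proof.
move=> t0; have dF := derivable_flow_fisher mu2 (clock_gt0 t0).
have := is_derive_comp_fun (g := fun t => clock t) (derivableP dF)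
  (is_derive_clock t0).
move=> hd; suff [] : is_derive t 1 (J1 X)
   ('D_1 (flow_fisher mu) (clock t) * (2 * H * t `^ (2 * H - 1))) by [].
apply: near_eq_is_derive hd.
by near=> u; rewrite J1_flow//; near: u; exact: near_pos.
Unshelve. all: end_near. Qed.

(** The first derivative of the entropy power, in the closed form that can be
differentiated again. *)
Definition entropy_power_dot t := N X t * (2 * H * t `^ (2 * H - 1) * J1 X t).

Lemma is_derive_N (t : R) : 0 < t -> is_derive t 1 (N X) (entropy_power_dot t).
Proof.
move=> t0; have dE := de_bruijn mu2 (clock_gt0 t0).
have d1 := is_derive_comp_fun (g := fun t => clock t) dE (is_derive_clock t0).
have d2 := is_deriveZ_fun (2 * pi * expR 1)^-1
  (is_derive_comp_fun (is_derive_expR _) (is_deriveZ_fun 2 d1)).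
apply: (near_eq_is_derive (f := fun t =>
  (2 * pi * expR 1)^-1 * expR (2 * flow_entropy mu (clock t)))).
  by near=> u; rewrite N_flow//; near: u; exact: near_pos.
by apply: (is_derive_eq d2); rewrite /entropy_power_dot N_flow// J1_flow//;
  set c := _^-1; field.
Unshelve. all: end_near. Qed.

(** The factor [t^(4H-2)] of [g] is the square of [t^(2H-1)], coming from the
derivative of [N] itself. *)
Lemma is_derive_entropy_power_dot (t : R) : 0 < t ->
  is_derive t 1 entropy_power_dot (2 * N X t * g H X t).
Proof.
move=> t0.
have dJ := derivableP (derivable_J1 t0).
have dP : is_derive t 1 (fun t => t `^ (2 * H - 1))
  ((2 * H - 1) * t `^ (2 * H - 1 - 1)).
  exact: is_derive1_powR.
apply: (is_derive_eq (is_deriveM_fun (is_derive_N t0)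
  (is_deriveM_fun (is_deriveZ_fun (2 * H) dP) dJ))).
rewrite /g /entropy_power_dot derive1E.
have -> : 4 * H - 2 = (2 * H - 1) + (2 * H - 1) by ring.
rewrite (@powRD _ t (2 * H - 1) (2 * H - 1));
  last by rewrite (gt_eqF t0) implybT.
have -> : 2 * H - 1 - 1 = 2 * H - 2 by ring.
by ring.
Qed.

Lemma is_derive_derive1_N (t : R) : 0 < t ->
  is_derive t 1 (N X)^`()%classic (2 * N X t * g H X t).
Proof.
move=> t0; apply: near_eq_is_derive (is_derive_entropy_power_dot t0).
near=> u; have u0 : 0 < u by near: u; exact: near_pos.
by rewrite derive1E; have [_ ->] := is_derive_N u0.
Unshelve. all: end_near. Qed.

Lemma convex_N (I : set R) : open I -> is_interval I ->
  I `<=` [set t | 0 < t] ->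
  (forall t, I t -> 0 <= g H X t) -> convex_on I (N X).
Proof.
move=> oI itI Ipos gI.
apply: (@second_derivative_convex_on _ I _ entropy_power_dot
  (fun t => 2 * N X t * g H X t)) => //.
- by move=> t /Ipos; exact: is_derive_N.
- by move=> t /Ipos; exact: is_derive_entropy_power_dot.
- by move=> t It; rewrite mulr_ge0 ?gI// mulr_ge0// ltW// N_gt0//; exact: Ipos.
Qed.

Lemma concave_N (I : set R) : open I -> is_interval I ->
  I `<=` [set t | 0 < t] ->
  (forall t, I t -> g H X t <= 0) -> concave_on I (N X).
Proof.
move=> oI itI Ipos gI.
apply: (@second_derivative_convex_on _ I _ (fun t => - entropy_power_dot t)
  (fun t => - (2 * N X t * g H X t))) => //.
- by move=> t /Ipos t0; apply: is_deriveN_fun; exact: is_derive_N.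
- by move=> t /Ipos t0; apply: is_deriveN_fun;
    exact: is_derive_entropy_power_dot.
- move=> t It; rewrite oppr_ge0 mulr_ge0_le0 ?gI// mulr_ge0// ltW// N_gt0//.
  exact: Ipos.
Qed.

Lemma J1_gaussian v t : 0 <= v -> gaussian_law P 0 v X0 -> 0 < t ->
  J1 X t = (clock t + v)^-1.
Proof.
by move=> v0 gX t0; rewrite J1_flow//
  (flow_fisher_gaussian v0 (clock_gt0 t0) gX).
Qed.

Lemma g_gaussian v t : 0 <= v -> gaussian_law P 0 v X0 -> 0 < t ->
  g H X t = H * (2 * H - 1) * t `^ (2 * H - 2) * J1 X t.
Proof.
move=> v0 gX t0; have s0 := clock_gt0 t0.
have sv0 : clock t + v != 0 by rewrite gt_eqF// ltr_wpDr.
have dJ : is_derive t 1 (J1 X)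
    (- (2 * H * t `^ (2 * H - 1)) / (clock t + v) ^+ 2).
  apply: (near_eq_is_derive (f := fun t => (clock t + v)^-1)).
    by near=> u; rewrite (J1_gaussian v0 gX)//; near: u; exact: near_pos.
  apply: (is_derive_eq (is_deriveV_fun (f := fun t => clock t + v) sv0
    (is_deriveD_fun (is_derive_clock t0) (is_derive_cst_fun v t)))).
  by rewrite addr0.
rewrite /g derive1E; have [_ ->] := dJ.
rewrite (J1_gaussian v0 gX)//.
have -> : 4 * H - 2 = (2 * H - 1) + (2 * H - 1) by ring.
rewrite (@powRD _ t (2 * H - 1) (2 * H - 1));
  last by rewrite (gt_eqF t0) implybT.
by field.
Unshelve. all: end_near. Qed.

End fbm_flow.

Theorem theorem3p2 (d : measure_display) (T : measurableType d) (R : realType)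
    (P : probability T R) (H : R) (X0 : {RV P >-> R})
    (B : R -> {RV P >-> R}) (X : R -> {RV P >-> R}) :
  0 < H -> H < 1 ->
  fractional_brownian_motion H B ->
  independent_rv_process X0 B ->
  ('E_P[(fun w => X0 w ^+ 2)%R] < +oo)%E ->
  (forall t w, 0 <= t -> X t w = X0 w + B t w) ->
  (forall t, 0 < t ->
    [/\ is_density (X t) (density (X t)),
        forall x, 0 < density (X t) x,
        forall x, derivable (density (X t)) x 1,
        entropy (X t) \is a fin_num &
        fisher_information (X t) \is a fin_num]) /\
  (forall t, 0 < t ->
    [/\ derivable (J1 X) t 1, derivable (N X) t 1 &
        derivable (N X)^`()%classic t 1]) /\
  (forall t, 0 < t -> (N X)^`(2)%classic t = 2 * N X t * g H X t) /\
  (forall I : set R, open I -> is_interval I -> I `<=` [set t | 0 < t] ->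
    ((forall t, I t -> 0 < g H X t) -> convex_on I (N X)) /\
    ((forall t, I t -> g H X t <= 0) -> concave_on I (N X))) /\
  (forall sigma0 : R, gaussian_law P 0 (sigma0 ^+ 2) X0 ->
    (forall t, 0 < t ->
      g H X t = H * (2 * H - 1) * t `^ (2 * H - 2) * J1 X t) /\
    (2^-1 < H -> convex_on [set t | 0 < t] (N X)) /\
    (H <= 2^-1 -> concave_on [set t | 0 < t] (N X))).
Proof.
move=> H0 _ fbmB indB X02 XE.
have mu2 := integrable_sqr_distribution X02.
split.
  move=> t t0; have s0 := clock_gt0 H t0.
  have dE := density_flow H0 fbmB indB XE t0; split.
  - by rewrite dE; exact: is_density_flow XE _ t0.
  - by move=> x; rewrite dE; exact: flow_density_gt0.
  - by move=> x; rewrite dE;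
      have [] := is_derive_flow_moment_x (distribution P X0) 0 x s0.
  - by rewrite (entropy_flow H0 fbmB indB X02 XE).
  - by rewrite (fisher_flow H0 fbmB indB X02 XE).
split.
  move=> t t0; split.
  - exact: (derivable_J1 H0 fbmB indB X02 XE).
  - by have [] := is_derive_N H0 fbmB indB X02 XE t0.
  - by have [] := is_derive_derive1_N H0 fbmB indB X02 XE t0.
split.
  move=> t t0; rewrite derive1nS/= derive1E.
  by have [_ ->] := is_derive_derive1_N H0 fbmB indB X02 XE t0.
split.
  move=> I oI itI Ipos; split => gI.
  - apply: (convex_N H0 fbmB indB X02 XE) => // t It.
    exact/ltW/gI.
  - exact: (concave_N H0 fbmB indB X02 XE).
move=> sigma0 gX; have v0 := sqr_ge0 sigma0.
have gE t : 0 < t -> g H X t = H * (2 * H - 1) * t `^ (2 * H - 2) * J1 X t.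
  exact: (g_gaussian H0 fbmB indB X02 XE v0 gX).
have J0 t : 0 < t -> 0 <= J1 X t.
  move=> t0; rewrite (J1_gaussian H0 fbmB indB X02 XE v0 gX t0) invr_ge0.
  by rewrite addr_ge0 ?powR_ge0.
have oP : open [set t : R | 0 < t] by exact: open_gt.
have iP : is_interval [set t : R | 0 < t].
  by move=> a b /= a0 _ z /andP[az _]; exact: lt_le_trans az.
split=> //; split => hH.
- apply: (convex_N H0 fbmB indB X02 XE) => // t /= t0; rewrite gE//.
  rewrite mulr_ge0 ?J0// mulr_ge0 ?powR_ge0// mulr_ge0 ?(ltW H0)//; lra.
- apply: (concave_N H0 fbmB indB X02 XE) => // t /= t0; rewrite gE//.
  rewrite mulr_le0_ge0 ?J0// mulr_le0_ge0 ?powR_ge0// mulr_ge0_le0 ?(ltW H0)//;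
    lra.
Qed.
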